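(* A $C^2$ function $f:\mathbb{R}^{n\times p}\to\mathbb{R}$ is matrix superharmonic if and only if its matrix Laplacian is negative semidefinite, $\widetilde{\Delta}f(X)\preceq O$, for every $X\in\mathbb{R}^{n\times p}$.
   Context: Let $S_{0,1}=\{e\in\mathbb{R}^n:\|e\|=1\}$, with surface area element $ds$ and surface area $\Omega_n$ (for $n=1$: counting measure on $\{-1,1\}$, $\Omega_1=2$). For $f:\mathbb{R}^{n\times p}\to\mathbb{R}\cup\{\infty\}$, $X\in\mathbb{R}^{n\times p}$, $\rho\in\mathbb{R}^p$, put $L(f:X,\rho)=\frac{1}{\Omega_n}\int_{S_{0,1}}f(X+e\rho^\top)\,ds(e)$. The function $f$ is matrix superharmonic if (1) $f$ is lower semicontinuous; (2) $f\not\equiv\infty$; (3) $L(f:X,\rho)\le f(X)$ for every $X\in\mathbb{R}^{n\times p}$ and $\rho\in\mathbb{R}^p$. The matrix Laplacian of a $C^2$ function $f$ is the $p\times p$ matrix function $(\widetilde\Delta f(X))_{ij}=\sum_{a=1}^n\frac{\partial^2}{\partial X_{ai}\partial X_{aj}}f(X)$. $A\preceq B$ means $B-A$ is positive semidefinite. *)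

(* Defs.v *)
From HB Require Import structures.
From mathcomp Require Import all_boot all_order all_algebra.
From mathcomp Require Import all_classical all_reals all_analysis.
From mathcomp Require Import measurable_realfun.

Set Implicit Arguments.
Unset Strict Implicit.
Unset Printing Implicit Defensive.

Import Order.TTheory GRing.Theory Num.Theory.
Import numFieldNormedType.Exports.

Local Open Scope classical_set_scope.
Local Open Scope ring_scope.

Lemma sigma_finite_product d1 d2 (T1 : measurableType d1)
    (T2 : measurableType d2) (R : realType)
    (m1 : {sigma_finite_measure set T1 -> \bar R})
    (m2 : {sigma_finite_measure set T2 -> \bar R}) :
  sigma_finite setT (m1 \x m2)%E.
Proof.
have /sigma_finiteP[F [TF ndF Foo]] := sigma_finiteT m1.
have /sigma_finiteP[G [TG ndG Goo]] := sigma_finiteT m2.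
exists (fun n => F n `*` G n) => [|k].
  rewrite -setXTT TF TG predeqE => -[x y]; split.
    move=> [/= [n _ Fnx] [k _ Gky]]; exists (maxn n k) => //; split.
    - by move: x Fnx; exact/subsetPset/ndF/leq_maxl.
    - by move: y Gky; exact/subsetPset/ndG/leq_maxr.
  by move=> [n _ []/= ? ?]; split; exists n.
have [? ?] := Foo k; have [? ?] := Goo k.
split; first exact: measurableX.
by rewrite product_measure1E// lte_mul_pinfty// ge0_fin_numE.
Qed.

Lemma sigma_finite_measure_pack d (T : measurableType d) (R : realType)
    (nu : set T -> \bar R) :
  nu set0 = 0%E -> (forall A, 0 <= nu A)%E -> semi_sigma_additive nu ->
  sigma_finite setT nu ->
  exists mu : {sigma_finite_measure set T -> \bar R},
    mu = nu :> (set T -> \bar R).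
Proof.
move=> nu0 nu_ge0 nu_sa nu_sf.
pose nu_measure := isMeasure.Build _ _ _ nu nu0 nu_ge0 nu_sa.
pose M : {measure set T -> \bar R} := HB.pack nu nu_measure.
pose nu_sigma_finite := Measure_isSigmaFinite.Build _ _ _ M nu_sf.
by exists (HB.pack_for {sigma_finite_measure set T -> \bar R}
  (M : set T -> \bar R) nu_measure nu_sigma_finite).
Qed.

(* R^n is modelled by n.-tuple R when it is integrated over: the library puts
   the product (Borel) sigma-algebra on tuples, and none on 'cV[R]_n. *)
Section lebesgue_tuple.
Context {R : realType}.

Definition tcons n (z : R * n.-tuple R) : n.+1.-tuple R :=
  [tuple of z.1 :: z.2].

Let idTR : measurableTypeR R -> R := idfun.

Let measurable_idTR : measurable_fun [set: measurableTypeR R] idTR.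
Proof. by move=> _ /= B mB; rewrite setTI. Qed.

Lemma measurable_tcons n :
  measurable_fun [set: measurableTypeR R * n.-tuple R] (@tcons n).
Proof.
apply: (@measurable_cons _ _ _ _ (idTR \o fst)) => //.
exact: measurableT_comp.
Qed.

Fixpoint lebesgue_tuple n : set (n.-tuple R) -> \bar R :=
  match n with
  | 0 => \d_[tuple]
  | m.+1 => pushforward (lebesgue_measure \x @lebesgue_tuple m)%E (@tcons m)
  end.

Lemma lebesgue_tuple_sigma_finite_measure n :
  exists mu : {sigma_finite_measure set (n.-tuple R) -> \bar R},
    mu = @lebesgue_tuple n :> (set _ -> _).
Proof.
elim: n => [|n [mu muE]] /=; first by exists \d_[tuple].
rewrite -muE.
set pm := (@lebesgue_measure R \x mu)%E; set nu := pushforward pm (@tcons n).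
have nu0 : nu set0 = 0%E.
  by rewrite /nu /pushforward preimage_set0 /pm measure0.
have nu_ge0 A : (0 <= nu A)%E by rewrite /nu /pushforward /pm measure_ge0.
have nu_sa : semi_sigma_additive nu.
  move=> F mF tF mUF; rewrite /nu /pushforward preimage_bigcup.
  have mtcons A : measurable A -> measurable (@tcons n @^-1` A).
    by move=> mA; rewrite -[X in measurable X]setTI; exact: measurable_tcons.
  apply: (@measure_semi_sigma_additive _ _ _ pm) => [k||].
  - exact: mtcons.
  - apply/trivIsetP => /= i j _ _ ij; rewrite -preimage_setI.
    by move/trivIsetP : tF => /(_ _ _ _ _ ij) ->//; rewrite preimage_set0.
  - by rewrite -preimage_bigcup; exact: mtcons.
have nu_sf : sigma_finite setT nu.
  have [G GT Goo] : sigma_finite setT pm by exact: sigma_finite_product.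
  pose h (t : n.+1.-tuple R) := (thead t, [tuple of behead t]).
  have hK : cancel (@tcons n) h.
    by move=> [x t]; rewrite /h /tcons theadE; congr pair; exact: val_inj.
  have mh : measurable_fun setT h.
    apply/measurable_fun_pair; last exact: measurable_behead.
    exact: measurable_tnth.
  exists (fun k => h @^-1` G k) => [|k]; first by rewrite -preimage_bigcup -GT.
  have [mG Gk] := Goo k; split.
    by rewrite -[X in measurable X]setTI; exact: mh.
  by rewrite /nu /pushforward -comp_preimage (_ : _ \o _ = id)//; apply/funext.
exact: sigma_finite_measure_pack nu0 nu_ge0 nu_sa nu_sf.
Qed.

Let lebesgue_tuple0 n : @lebesgue_tuple n set0 = 0%E.
Proof. by have [mu <-] := lebesgue_tuple_sigma_finite_measure n. Qed.

Let lebesgue_tuple_ge0 n A : (0 <= @lebesgue_tuple n A)%E.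
Proof. by have [mu <-] := lebesgue_tuple_sigma_finite_measure n. Qed.

Let lebesgue_tuple_sigma_additive n : semi_sigma_additive (@lebesgue_tuple n).
Proof.
have [mu <-] := lebesgue_tuple_sigma_finite_measure n.
exact: measure_semi_sigma_additive.
Qed.

HB.instance Definition _ n := isMeasure.Build _ _ _ (@lebesgue_tuple n)
  (lebesgue_tuple0 n) (lebesgue_tuple_ge0 (n := n))
  (@lebesgue_tuple_sigma_additive n).

Let lebesgue_tuple_sigma_finite n : sigma_finite setT (@lebesgue_tuple n).
Proof.
by have [mu <-] := lebesgue_tuple_sigma_finite_measure n; exact: sigma_finiteT.
Qed.

HB.instance Definition _ n := Measure_isSigmaFinite.Build _ _ _
  (@lebesgue_tuple n) (@lebesgue_tuple_sigma_finite n).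

End lebesgue_tuple.

Section sphere.
Context {R : realType} (n : nat).
Implicit Types (x : n.-tuple R) (A : set (n.-tuple R)).

(* Euclidean norm: the library's norm on 'cV[R]_n is the sup norm. *)
Definition enorm x : R := Num.sqrt (\sum_(i < n) tnth x i ^+ 2).

Definition unit_sphere : set (n.-tuple R) := [set x | enorm x = 1].

Definition radial_proj x : n.-tuple R := [tuple tnth x i / enorm x | i < n].

(* Surface measure of the unit sphere, in its standard polar-coordinates form:
   the area of A is n times the volume of the cone over A, namely
   {x | 0 < |x| <= 1, x / |x| \in A}.  For n = 1 this is the
   counting measure on {-1, 1}. *)
Definition sphere_measure A : \bar R :=
  (n%:R%:E *
   lebesgue_tuple [set x | A (radial_proj x) /\ (0 < enorm x <= 1)%R])%E.

Lemma measurable_enorm : measurable_fun [set: n.-tuple R] enorm.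
Proof.
rewrite (_ : enorm = @powR R ^~ 2^-1 \o fun x => \sum_(i < n) tnth x i ^+ 2).
  apply: measurableT_comp => //; apply: measurable_sum => i.
  by apply: measurable_funX; exact: measurable_tnth.
apply/funext => x /=; rewrite powR12_sqrt//.
by apply: sumr_ge0 => i _; exact: sqr_ge0.
Qed.

Lemma measurable_radial_proj : measurable_fun [set: n.-tuple R] radial_proj.
Proof.
apply/measurable_fun_tnthP => i.
rewrite (_ : _ \o _ = (fun x => tnth x i * (enorm x) `^ (-1))); last first.
  by apply/funext => x /=; rewrite tnth_mktuple powR_inv1// sqrtr_ge0.
apply: measurable_funM; first exact: measurable_tnth.
by apply: (measurableT_comp (measurable_powR (-1))); exact: measurable_enorm.
Qed.

Let mball : measurable [set x | 0 < enorm x <= 1].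
Proof.
rewrite (_ : mkset _ = enorm @^-1` `]0, 1]).
  by rewrite -[X in measurable X]setTI; exact: measurable_enorm.
by apply/seteqP; split => x /=; rewrite in_itv.
Qed.

Let mcone A : measurable A ->
  measurable [set x | A (radial_proj x) /\ 0 < enorm x <= 1].
Proof.
move=> mA; apply: (measurableI (radial_proj @^-1` A)) => //.
by rewrite -[X in measurable X]setTI; exact: measurable_radial_proj.
Qed.

Let sphere_measure0 : sphere_measure set0 = 0%E.
Proof.
rewrite /sphere_measure (_ : mkset _ = set0) ?measure0 ?mule0//.
by apply/seteqP; split => // x [].
Qed.

Let sphere_measure_ge0 A : (0 <= sphere_measure A)%E.
Proof. by rewrite mule_ge0// lee_fin. Qed.

Let sphere_measure_sigma_additive : semi_sigma_additive sphere_measure.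
Proof.
move=> F mF tF mUF.
pose C k := [set x | F k (radial_proj x) /\ 0 < enorm x <= 1].
have CE : [set x | (\bigcup_k F k) (radial_proj x) /\ 0 < enorm x <= 1] =
    \bigcup_k C k.
  by apply/seteqP; split => [x [[k _ Fk] x1]|x [k _ [Fk x1]]];
    [exists k|split => //; exists k].
rewrite /sphere_measure CE.
have : semi_sigma_additive
    (mscale (NngNum (ler0n R n)) (@lebesgue_tuple R n)).
  exact: measure_semi_sigma_additive.
apply.
- by move=> k; exact: mcone.
- apply/trivIsetP => i j _ _ ij; apply/seteqP; split => // x [[Fi _] [Fj _]].
  move/trivIsetP : tF => /(_ _ _ Logic.I Logic.I ij) Fij.
  by have : set0 (radial_proj x) by rewrite -Fij.
- by rewrite -CE; exact: mcone.
Qed.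

HB.instance Definition _ := isMeasure.Build _ _ _ sphere_measure
  sphere_measure0 sphere_measure_ge0 sphere_measure_sigma_additive.

End sphere.

Section matrix_superharmonic.
Context {R : realType} (n p : nat).
Implicit Types (f : 'M[R]_(n, p) -> \bar R).
Implicit Types (X : 'M[R]_(n, p)) (rho : 'cV[R]_p).

Definition col_of_tuple (e : n.-tuple R) : 'cV[R]_n := \col_i tnth e i.

Definition sphere_area : R := fine (sphere_measure (@unit_sphere R n)).

Definition sphere_mean f X rho : \bar R :=
  (sphere_area^-1%:E *
   \int[@sphere_measure R n]_(e in @unit_sphere R n)
     f (X + col_of_tuple e *m rho^T)%R)%E.

(* The first condition says that f takes its values in R U {+oo}. *)
Definition matrix_superharmonic f : Prop :=
  [/\ forall X, f X != -oo%E,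
      lower_semicontinuous f,
      exists X, f X != +oo%E &
      forall X rho, (sphere_mean f X rho <= f X)%E].

End matrix_superharmonic.

Section matrix_laplacian.
Context {R : realType} (n p : nat).
Implicit Types (f : 'M[R]_(n, p) -> R) (X : 'M[R]_(n, p)).

Definition mx_partial (a : 'I_n) (i : 'I_p) f X : R := 'D_(delta_mx a i) f X.

Definition C1 f : Prop :=
  continuous f /\
  forall a i, (forall X, derivable f X (delta_mx a i)) /\
              continuous (mx_partial a i f).

Definition C2 f : Prop := C1 f /\ forall a i, C1 (mx_partial a i f).

Definition matrix_laplacian f X : 'M[R]_p :=
  \matrix_(i, j) \sum_(a < n) mx_partial a i (mx_partial a j f) X.

End matrix_laplacian.

Section loewner_order.
Context {R : realType} (p : nat).
Implicit Types A B : 'M[R]_p.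

Definition psdmx A : Prop :=
  A^T = A /\ forall v : 'cV[R]_p, 0 <= (v^T *m A *m v) 0 0.

Definition loewner_le A B : Prop := psdmx (B - A).

End loewner_order.

(* Main.v *)
Require Import Defs.
From HB Require Import structures.
From mathcomp Require Import all_boot all_order all_algebra.
From mathcomp Require Import all_classical all_reals all_analysis.
From mathcomp Require Import measurable_realfun ring lra.

(**
For fixed X and rho put g(y) = f(X + y rho^T), a C^2 function on R^n whose
Laplacian at y is rho^T L(X + y rho^T) rho, where L is the matrix Laplacian,
and let M(r) be the mean of g over the sphere of radius r; the mean inequality
for (X, r rho) reads M(r) <= g(0). A second-order Taylor expansion that is
uniform on the sphere gives M(r + h) = M(r) + h m1 + h^2/2 m2 + o(h^2), with
m1 and m2 the means of the first and second radial derivatives. At r = 0 the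
moments of the sphere give m1 = 0 and m2 = (Laplacian of g at 0) / n, whence
the direct implication.

For the converse, invariance of the mean under rotations makes the mean of
x_a d_b k - x_b d_a k vanish for every C^1 function k. Summing over a <> b with
k(x) = x_a (d_b g)(r x) yields r mean(Laplacian of g) = r m2 + (n - 1) m1, so no
divergence theorem is needed. If M(1) > g(0), then M(r) - eta r^2 has, for a
small eta > 0, a minimum over [0, 1] at some c < 1, where m1 = 2 eta c and
m2 >= 2 eta; this contradicts the sign of the Laplacian.

Rotation invariance of Lebesgue measure comes from writing a plane rotation as a
product of three transvections, each of which preserves the measure by Fubini
and translation invariance.
*)

Set Implicit Arguments.
Unset Strict Implicit.
Unset Printing Implicit Defensive.

Import Order.TTheory GRing.Theory Num.Theory.
Import numFieldNormedType.Exports.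

Local Open Scope classical_set_scope.
Local Open Scope ring_scope.

(** * Directional derivatives *)

Section directional.
Context {R : realType}.
Implicit Types V W : normedModType R.

(** A directional derivative depends only on increments, so it passes between functions on different
    spaces. Restrictions to lines, translates, dilations and slices are all treated this way. *)
Lemma is_derive_quotient V W (f : V -> R) (g : W -> R) a v b w df :
  (forall h, f (h *: v + a) - f a = g (h *: w + b) - g b) ->
  is_derive a v f df -> is_derive b w g df.
Proof.
move=> fg [cf vf].
have E : (fun h : R => h^-1 *: (f (h *: v + a) - f a)) =
         (fun h : R => h^-1 *: (g (h *: w + b) - g b)).
  by apply/funext => h; rewrite fg.
split; first by move: cf; rewrite /derivable E.
by move: vf; rewrite /derive E.
Qed.

Lemma is_derive_line V (f : V -> R) y w t df :
  is_derive (y + t *: w) w f df ->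
  is_derive t (1 : R) (fun s : R => f (y + s *: w)) df.
Proof.
apply: is_derive_quotient => h.
by rewrite [h *: 1]mulr1 scalerDl addrCA.
Qed.

Lemma is_derive_continuous (f : R -> R) (x : R) df :
  is_derive x (1 : R) f df -> {for x, continuous f}.
Proof. by move=> [? _]; apply/differentiable_continuous/derivable1_diffP. Qed.

Lemma MVT_line V (f : V -> R) (df : V -> R) y w :
  (forall z, is_derive z w f (df z)) ->
  exists2 t, 0 <= t <= 1 & f (y + w) - f y = df (y + t *: w).
Proof.
move=> fd.
have D (t : R) : is_derive t (1 : R) (fun s :
  R => f (y + s *: w)) (df (y + t *: w)).
  exact: is_derive_line.
have C : {within `[0 : R, 1], continuous (fun s : R => f (y + s *: w))}.
  by apply: continuous_subspaceT => x; exact: is_derive_continuous (D x).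
have [t t01] := MVT_segment ler01 (fun x _ => D x) C.
rewrite scale1r scale0r addr0 subr0 mulr1 => E; exists t => //.
Qed.

Lemma is_deriveP V (f : V -> R) a v df :
  is_derive a v f df <-> h^-1 *: (f (h *: v + a) - f a) @[h --> 0^'] --> df.
Proof.
split; first by move=> [+ <-].
by move=> fc; split; [apply/cvg_ex; exists df|exact/cvg_lim].
Qed.

(** The one-variable chain rule, applied to the restriction of [f] to the line through [a]
    precomposed with s -> c s, requires derivability in the direction [v] alone. *)
Lemma is_derive_scale V (f : V -> R) a v df c :
  is_derive a v f df -> is_derive a (c *: v) f (c * df).
Proof.
have [->|c0] := eqVneq c 0.
  move=> _; rewrite scale0r mul0r; split; first exact: derivable0.
  exact: derive0.
move=> fd.
have L : is_derive (0 : R) (1 : R) (fun s : R => f (a + s *: v)) df.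
  by apply: is_derive_line; rewrite scale0r addr0.
have L2 : is_derive (0 : R) (1 : R) ((fun s :
  R => f (a + s *: v)) \o (fun s => c * s)) (c * df).
  have -> : c * df = df * c by rewrite mulrC.
  have Lc : is_derive ((fun s : R => c * s) 0) (1 : R) (fun s :
    R => f (a + s *: v)) df.
    by rewrite mulr0.
  have Ls : is_derive (0 : R) (1 : R) (fun s : R => c * s) c.
    have -> : (fun s : R => c * s) = c \*: (id : R -> R) by [].
    by apply: is_derive_eq; rewrite [LHS]mulr1.
  exact: is_derive1_comp Lc Ls.
apply: is_derive_quotient L2 => h /=.
rewrite [h *: 1]mulr1 addr0 mulr0 scale0r addr0 scalerA [c * h]mulrC.
by rewrite [a + _]addrC.
Qed.

(* The increment along [u] is rewritten by the mean value theorem at a point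
   converging to the base point, so that continuity of [du] suffices. *)
Lemma is_deriveD_dir V (f : V -> R) (du : V -> R) a u v dv :
  (forall z, is_derive z u f (du z)) -> {for a, continuous du} ->
  is_derive a v f dv -> is_derive a (u + v) f (du a + dv).
Proof.
move=> fu cdu /is_deriveP fv; apply/is_deriveP.
rewrite (_ : (fun h : R => _) = (fun h : R =>
  h^-1 *: (f (h *: u + (h *: v + a)) - f (h *: v + a)) +
  h^-1 *: (f (h *: v + a) - f a))); last first.
  by apply/funext => h; rewrite -scalerDr addrA subrK addrA -scalerDr.
apply: cvgD => //.
have /choice[t tP] (h : R) : exists t, 0 <= t <= 1 /\
    f (h *: u + (h *: v + a)) - f (h *: v + a) =
    h * du (h *: v + a + t *: (h *: u)).
  have [t t01 E] := @MVT_line V f (fun z => h * du z) (h *: v + a) (h *: u)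
    (fun z => is_derive_scale h (fu z)).
  by exists t; split => //; rewrite (addrC (h *: u)) E.
apply: (@cvg_trans _ ((fun h : R => du (h *: v + a + t h *: (h *: u))) @ 0^')).
  apply: near_eq_cvg; near=> h.
  have [_ ->] := tP h; rewrite /GRing.scale /= mulKf//.
  by near: h; exact: nbhs_dnbhs_neq.
apply: (@cvg_comp _ _ _ (fun h : R => h *: v + a + t h *: (h *: u)) du
  _ (nbhs a) _ _ cdu).
apply/cvgrPdist_lt => e e0; near=> h.
rewrite [_ + a]addrC -addrA opprD addrA subrr add0r normrN.
have [/andP[t0 t1] _] := tP h.
rewrite (@le_lt_trans _ _ (`|h| * (`|v| + `|u|)))//.
  rewrite (le_trans (ler_normD _ _))// mulrDr !normrZ lerD2l.
  by rewrite (ger0_norm t0) ler_piMl// mulr_ge0.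
rewrite (@le_lt_trans _ _ (`|h| * (`|v| + `|u| + 1)))//.
  by rewrite ler_wpM2l// lerDl.
rewrite -ltr_pdivlMr; last by rewrite ltr_wpDl// addr_ge0.
near: h; apply: dnbhs0_lt; rewrite divr_gt0// ltr_wpDl//.
Unshelve. all: by end_near. Qed.

(** The second difference of [f] is the increment along [u] of f(z + v) - f(z); one mean value step
    along [u] and one along [v] give the intermediate point. *)
Lemma mixed_difference V (f fu fuv : V -> R) u v y :
  (forall z, is_derive z u f (fu z)) -> (forall z, is_derive z v fu (fuv z)) ->
  exists st, [/\ 0 <= st.1 <= 1, 0 <= st.2 <= 1 &
    f (y + u + v) - f (y + u) - f (y + v) + f y =
    fuv (y + st.1 *: u + st.2 *: v)].
Proof.
move=> dfu dfuv.
pose h z := f (z + v) - f z.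
have dh z : is_derive z u h (fu (z + v) - fu z).
  have d1 : is_derive z u (fun z => f (z + v)) (fu (z + v)).
    by apply: (is_derive_quotient _ (dfu (z + v))) => k; rewrite addrA.
  exact: is_deriveB.
have [s s01 hE] := MVT_line y dh.
have [t t01 fuE] := MVT_line (y + s *: u) dfuv.
exists (s, t); split => //=; rewrite -fuE -hE /h.
by ring.
Qed.

(** Schwarz's theorem: the second difference over h u and h v is symmetric in the two directions, so
    it equals h^2 [fuv] at one point and h^2 [fvu] at another, both close to [y]; continuity at [y]
    concludes. *)
Lemma mixed_partial_sym V (f fu fv fuv fvu : V -> R) u v y :
  (forall z, is_derive z u f (fu z)) -> (forall z, is_derive z v f (fv z)) ->
  (forall z, is_derive z v fu (fuv z)) -> (forall z,
    is_derive z u fv (fvu z)) ->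
  {for y, continuous fuv} -> {for y, continuous fvu} -> fuv y = fvu y.
Proof.
move=> dfu dfv dfuv dfvu cuv cvu.
apply/eqP; rewrite -subr_eq0 -normr_eq0; apply/eqP/le_anti.
rewrite normr_ge0 andbT; apply/ler_addgt0Pl => e e0; rewrite addr0.
have e2 : 0 < e / 2 by rewrite divr_gt0.
have /cvgrPdist_lt /(_ _ e2) /nbhs_ballP[d1 /= d10 H1] := cuv.
have /cvgrPdist_lt /(_ _ e2) /nbhs_ballP[d2 /= d20 H2] := cvu.
pose d := Num.min d1 d2; have d0 : 0 < d by rewrite lt_min d10 d20.
pose N := `|u| + `|v| + 1; have N0 : 0 < N by rewrite ltr_wpDl// addr_ge0.
(* The summand 1 in [N] allows division even when both directions are zero. *)
have [h h0 hN] : exists2 h, 0 < h & h * (`|u| + `|v|) < d.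
  exists (d / N / 2); first by rewrite !divr_gt0.
  apply: (@lt_le_trans _ _ (d / N / 2 * N)).
    by rewrite ltr_pM2l ?divr_gt0// /N ltrDl.
  by rewrite mulrAC divfK ?gt_eqF//; lra.
have B s t a b : 0 <= s <= 1 -> 0 <= t <= 1 -> `|a| + `|b| = `|u| + `|v| ->
    `|y - (y + s *: (h *: a) + t *: (h *: b))| < d.
  move=> /andP[s0 s1] /andP[t0 t1] ab.
  rewrite opprD opprD !addrA subrr sub0r -opprD normrN.
  rewrite (le_lt_trans _ hN)// -ab mulrDr (le_trans (ler_normD _ _))//.
  rewrite !normrZ (ger0_norm s0) (ger0_norm t0) (gtr0_norm h0).
  by rewrite lerD// ler_piMl// mulr_ge0// ltW.
have Z w k (k1 : V -> R) : (forall z, is_derive z w k (k1 z)) ->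
    forall z, is_derive z (h *: w) (fun z => h * k z) (h * (h * k1 z)).
  by move=> dk z; apply: is_derive_scale; exact: is_deriveZ.
have [[s1 t1] /= [s01 t01 E1]] :=
  mixed_difference y (fun z => is_derive_scale h (dfu z)) (Z _ _ _ dfuv).
have [[s2 t2] /= [s02 t02 E2]] :=
  mixed_difference y (fun z => is_derive_scale h (dfv z)) (Z _ _ _ dfvu).
set z1 := (X in fuv X) in E1; set z2 := (X in fvu X) in E2.
have zE : fuv z1 = fvu z2.
  apply: (mulfI (lt0r_neq0 h0)); apply: (mulfI (lt0r_neq0 h0)).
  by rewrite -E1 -E2 [y + h *: v + _]addrAC; ring.
have B1 : ball y d1 z1.
  by rewrite -ball_normE /=; apply: lt_le_trans (B _ _ _ _ s01 t01 _) _;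
     rewrite // ge_min lexx.
have B2 : ball y d2 z2.
  by rewrite -ball_normE /=; apply: lt_le_trans (B _ _ _ _ s02 t02 _) _;
     rewrite 1?addrC // ge_min lexx orbT.
have := H1 _ B1; have := H2 _ B2; rewrite /= zE => h2 h1.
rewrite ltW// (_ : _ - _ = (fuv y - fvu z2) - (fvu y - fvu z2)); last by ring.
by rewrite (le_lt_trans (ler_normB _ _))// [e]splitr ltrD.
Qed.

End directional.

(** * Derivatives of C^1 and C^2 functions of a matrix *)

Section matrix_derivatives.
Context {R : realType} (n p : nat).
Implicit Types (f : 'M[R]_(n, p) -> R) (X H : 'M[R]_(n, p)).

(** [H] is a sum of multiples of elementary matrices, and these directions are added one at a time
    by [is_deriveD_dir], which uses the continuity of each partial derivative. *)
Lemma C1_is_derive f X H : C1 f ->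
  is_derive X H f (\sum_a \sum_i H a i * mx_partial a i f X).
Proof.
move=> [_ fd]; rewrite [X in is_derive _ X](matrix_sum_delta H).
have D a i Z : is_derive Z (H a i *: delta_mx a i) f (H a i * mx_partial a i f
  Z).
  by apply: is_derive_scale; apply/derivableP; exact: (fd a i).1.
have C a i : continuous (fun Z => H a i * mx_partial a i f Z).
  by move=> Z; apply: continuousM; [exact: cst_continuous|exact: (fd a i).2].
rewrite !pair_big /=.
elim: (index_enum _) => [|q s IH].
  by rewrite !big_nil; split; [exact: derivable0|exact: derive0].
by rewrite !big_cons; exact: is_deriveD_dir (D q.1 q.2) (C q.1 q.2 X) IH.
Qed.

Lemma C2_mixed_partial_sym f a i b j : C2 f ->
  mx_partial a i (mx_partial b j f) = mx_partial b j (mx_partial a i f).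
Proof.
move=> [[_ f1] f2]; apply/funext => X.
have D c k (g : 'M[R]_(n, p) -> R) : C1 g ->
  forall Z, is_derive Z (delta_mx c k) g (mx_partial c k g Z).
  by move=> [_ /(_ c k)[+ _]] Z => /(_ Z); exact: derivableP.
have Df c k : forall Z, is_derive Z (delta_mx c k) f (mx_partial c k f Z).
  by move=> Z; apply/derivableP; exact: (f1 c k).1.
apply: (mixed_partial_sym (Df b j) (Df a i) (D a i _ (f2 b j))
  (D b j _ (f2 a i))).
  exact: ((f2 b j).2 a i).2.
exact: ((f2 a i).2 b j).2.
Qed.

End matrix_derivatives.

(** * Shear invariance of Lebesgue measure *)

Section lebesgue_shear.
Context {R : realType}.
Local Notation mu := (@lebesgue_measure R).

(** The translated measure agrees with Lebesgue measure on half-open intervals, which determine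
    it. *)
Lemma lebesgue_measure_translation (c : R) (A : set (measurableTypeR R)) :
  measurable A -> mu ((fun x => x + c) @^-1` A) = mu A.
Proof.
move=> mA.
pose tr := (fun x => x + c) : measurableTypeR R -> measurableTypeR R.
have mtr : measurable_fun setT tr by exact: measurable_funD.
rewrite -[LHS]/(pushforward mu tr A); apply/esym/lebesgue_measure_unique => //=.
move=> _ [[a b]] _ <-.
rewrite /pushforward (_ : _ @^-1` _ = `]a - c, b - c]%classic); last first.
  by apply/seteqP; split => x /=; rewrite !in_itv /= ltrBlDr lerBrDr.
by rewrite !lebesgue_measure_itv/= !lte_fin ltrD2r; case: ifP => // _;
  congr EFin; ring.
Qed.

Lemma lebesgue_measure_flip_translation (b : bool) (c : R)
    (A : set (measurableTypeR R)) :
  measurable A -> mu ((fun x => (-1) ^+ b * x + c) @^-1` A) = mu A.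
Proof.
case: b => mA; last first.
  by rewrite -[RHS](lebesgue_measure_translation c)//; congr (mu _);
     apply/seteqP; split => x /=; rewrite expr0 mul1r.
rewrite -[RHS](lebesgue_measure_translation c)//.
rewrite -[RHS]lebesgue_measureN; last first.
  rewrite -[X in measurable X]setTI.
  have : measurable_fun setT
      ((fun x => x + c) : measurableTypeR R -> measurableTypeR R).
    exact: measurable_funD.
  exact.
by congr (mu _); apply/seteqP; split => x /=; rewrite expr1 mulN1r.
Qed.

(** A single family covers both transvections ([b] false, [phi] linear) and coordinate reflections
    ([b] true, [phi] zero), so one invariance proof serves for both. *)
Definition shear n (a : 'I_n) (b : bool) (phi : n.-tuple R -> R)
    (x : n.-tuple R) : n.-tuple R :=
  [tuple if i == a then (-1) ^+ b * tnth x i + phi x else tnth x i | i < n].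

Lemma measurable_shear n (a : 'I_n) b phi :
  measurable_fun setT phi -> measurable_fun setT (shear a b phi).
Proof.
move=> mphi; apply/measurable_fun_tnthP => i.
have [ia|ia] := eqVneq i a; last first.
  rewrite (_ : _ \o _ = (fun x => tnth x i)); first exact: measurable_tnth.
  by apply/funext => x /=; rewrite tnth_mktuple (negbTE ia).
rewrite (_ : _ \o _ = (fun x => (-1) ^+ b * tnth x i + phi x)).
  by apply: measurable_funD => //; apply: measurable_funM => //;
    exact: measurable_tnth.
by apply/funext => x /=; rewrite tnth_mktuple ia eqxx.
Qed.

Lemma lebesgue_tupleS n (A : set (n.+1.-tuple R)) :
  lebesgue_tuple A = (mu \x @lebesgue_tuple R n)%E (@tcons R n @^-1` A).
Proof. by []. Qed.

Lemma shear_tcons0 n b phi x (t : n.-tuple R) :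
  shear ord0 b phi (tcons (x, t)) =
  tcons ((-1) ^+ b * x + phi (tcons (x, t)), t).
Proof.
apply: eq_from_tnth => i; rewrite tnth_mktuple.
case: (unliftP ord0 i) => [j ->|->]; last by rewrite eqxx !tnth0.
by rewrite eq_sym (negbTE (neq_lift _ _)) !tnthS.
Qed.

Lemma shear_tconsS n (a : 'I_n) b phi x (t : n.-tuple R) :
  shear (lift ord0 a) b phi (tcons (x, t)) =
  tcons (x, shear a b (fun t => phi (tcons (x, t))) t).
Proof.
apply: eq_from_tnth => i; rewrite tnth_mktuple.
case: (unliftP ord0 i) => [j ->|->].
  by rewrite !tnthS tnth_mktuple (inj_eq (@lift_inj _ _)).
by rewrite (negbTE (neq_lift _ _)) !tnth0.
Qed.

(** Induction on the dimension. If [a] is not the first coordinate, each section at a fixed first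
    coordinate is sheared in lower dimension. If it is, then for fixed remaining coordinates [phi]
    is constant, and the shear is a translation of the line, possibly after a reflection. *)
Lemma lebesgue_tuple_shear n (a : 'I_n) b phi (A : set (n.-tuple R)) :
  measurable_fun setT phi ->
  (forall x y, (forall i, i != a -> tnth x i = tnth y i) -> phi x = phi y) ->
  measurable A -> lebesgue_tuple (shear a b phi @^-1` A) = lebesgue_tuple A.
Proof.
elim: n => [|n IH] in a phi A *; first by case: a.
move=> mphi phia mA.
have mS : measurable (shear a b phi @^-1` A).
  by rewrite -[X in measurable X]setTI; exact: (measurable_shear a b mphi).
have mT B : measurable B -> measurable (@tcons R n @^-1` B).
  by move=> mB; rewrite -[X in measurable X]setTI; exact: measurable_tcons.
rewrite !lebesgue_tupleS.
case: (unliftP ord0 a) => [a' aE|aE].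
  rewrite /product_measure1; apply: eq_integral => x _ /=.
  rewrite !xsectionE.
  pose phix t := phi (tcons (x, t)).
  have mcx : measurable_fun setT (fun t : n.-tuple R => tcons (x, t)).
    by exact: (measurableT_comp (@measurable_tcons R n) (measurable_pair1 x)).
  rewrite -[RHS](IH a' phix); last 3 first.
  - exact: measurableT_comp.
  - move=> t u tu; apply: phia => i; rewrite aE.
    case: (unliftP ord0 i) => [j ->|->]; last by rewrite !tnth0.
    by rewrite (inj_eq (@lift_inj _ _)) !tnthS => /tu.
  - by rewrite -xsectionE; apply: measurable_xsection; exact: mT.
  congr lebesgue_tuple; apply/seteqP.
  by split => t /=; rewrite aE shear_tconsS.
(* The order of integration is exchanged, so that the first coordinate is the inner variable. *)
rewrite !(product_measure_unique (m' := (mu \x^ @lebesgue_tuple R n)%E));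
  [|exact: product_measure2E|exact: mT|exact: product_measure2E|exact: mT].
rewrite /product_measure2; apply: eq_integral => t _ /=.
rewrite !ysectionE.
pose c := phi (tcons (0, t)).
rewrite -[RHS](lebesgue_measure_flip_translation b c); last first.
  by rewrite -ysectionE; apply: measurable_ysection; exact: mT.
congr mu; apply/seteqP.
have cE x : phi (tcons (x, t)) = c.
  apply: phia => i; rewrite aE.
  by case: (unliftP ord0 i) => [j ->|->]; rewrite ?eqxx// !tnthS.
by split => x /=; rewrite aE shear_tcons0 cE.
Qed.

End lebesgue_shear.

(** * Invariance of the sphere measure *)

Section sphere_invariance.
Context {R : realType}.

Lemma sqr_enorm n (x : n.-tuple R) : enorm x ^+ 2 = \sum_(i < n) tnth x i ^+ 2.
Proof. by rewrite sqr_sqrtr// sumr_ge0// => i _; exact: sqr_ge0. Qed.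

Lemma enorm_radial_proj n (x : n.-tuple R) :
  0 < enorm x -> enorm (radial_proj x) = 1.
Proof.
move=> x0; rewrite /enorm -[RHS]sqrtr1; congr Num.sqrt.
under eq_bigr do rewrite tnth_mktuple exprMn.
by rewrite -mulr_suml -sqr_enorm -exprMn divff ?expr1n// gt_eqF.
Qed.

Lemma measurable_punctured_ball n :
  measurable [set x : n.-tuple R | 0 < enorm x <= 1].
Proof.
rewrite (_ : mkset _ = (@enorm R n) @^-1` `]0, 1]).
  by rewrite -[X in measurable X]setTI; exact: measurable_enorm.
by apply/seteqP; split => x /=; rewrite in_itv.
Qed.

(** As [T] preserves the norm and commutes with radial projection, the cone over the preimage of [A]
    is the preimage of the cone over [A]. *)
Lemma sphere_measure_invariant n (T : n.-tuple R -> n.-tuple R) A :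
  (forall B, measurable B -> lebesgue_tuple (T @^-1` B) = lebesgue_tuple B) ->
  (forall x, enorm (T x) = enorm x) ->
  (forall x, radial_proj (T x) = T (radial_proj x)) ->
  measurable A -> sphere_measure (T @^-1` A) = sphere_measure A.
Proof.
move=> TL Tn Tr mA; rewrite /sphere_measure; congr (_ * _)%E.
have mB := @measurable_punctured_ball n.
have mC : measurable [set x | A (radial_proj x) /\ 0 < enorm x <= 1].
  apply: (measurableI (radial_proj (n := n) @^-1` A)) => //.
  by rewrite -[X in measurable X]setTI; exact: measurable_radial_proj.
rewrite -[RHS]TL//; congr lebesgue_tuple.
by apply/seteqP; split => x /=; rewrite Tr Tn.
Qed.

(** These cubes bound the area of the sphere from both sides. Excluding the lower end keeps the cube
    with [a] = 0 away from the origin. *)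
Definition cube n (a b : R) := [set x : n.-tuple R | forall i,
  a < tnth x i <= b].

Lemma measurable_cube n a b : measurable (@cube n a b).
Proof.
rewrite (_ : @cube n a b = \bigcap_(i in [set: 'I_n]) ((@tnth n R)^~ i @^-1`
  `]a, b])).
  apply: fin_bigcap_measurable => // i _.
  by rewrite -[X in measurable X]setTI; exact: measurable_tnth.
by apply/seteqP; split => x /= H i; have := H i; rewrite /= in_itv //=; exact.
Qed.

Lemma lebesgue_cube n a b : a <= b ->
  lebesgue_tuple (@cube n a b) = ((b - a) ^+ n)%:E.
Proof.
move=> ab; elim: n => [|n IH].
  by rewrite /lebesgue_tuple /dirac indicE mem_set// => -[].
rewrite lebesgue_tupleS (_ : _ @^-1` _ = `]a, b]%classic `*` @cube n a b).
  rewrite product_measure1E//; last exact: measurable_cube.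
  rewrite /= lebesgue_measure_itv /= IH lte_fin exprS EFinM.
  by case: ltgtP ab => // -> _; rewrite subrr mul0e.
apply/seteqP; split => [[x t] /= H|[x t] [/= x1 t1] i].
  split => [|i]; first by have := H ord0; rewrite in_itv tnth0.
  by have := H (lift ord0 i); rewrite tnthS.
case: (unliftP ord0 i) => [j ->|->]; first by rewrite tnthS; exact: t1.
by rewrite tnth0; rewrite in_itv in x1.
Qed.

Lemma sphere_measure_unit_sphereE n : sphere_measure (@unit_sphere R n) =
  (n%:R%:E * lebesgue_tuple [set x : n.-tuple R | (0 < enorm x <= 1)%R])%E.
Proof.
rewrite /sphere_measure; congr (_ * lebesgue_tuple _)%E.
apply/seteqP; split => x /=; first by case.
by move=> x1; split => //; apply: enorm_radial_proj; case/andP: x1.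
Qed.

Lemma sphere_measure_unit_sphere_lty n :
  (sphere_measure (@unit_sphere R n) < +oo)%E.
Proof.
rewrite sphere_measure_unit_sphereE lte_mul_pinfty//.
(* The coordinate -1 occurs in the ball and the lower end of the cube is excluded, hence -2. *)
apply: (@le_lt_trans _ _ (lebesgue_tuple (@cube n (- 2) 1))).
  apply: le_measure; rewrite ?inE.
  - exact: measurable_punctured_ball.
  - exact: measurable_cube.
  move=> x /= /andP[x0 x1] i.
  suff : `|tnth x i| <= 1 by rewrite ler_norml => /andP[? ?]; lra.
  rewrite -(@ler_pXn2r _ 2)// ?nnegrE// expr1n real_normK ?num_real//.
  rewrite (@le_trans _ _ (enorm x ^+ 2))//; last by rewrite expr_le1// ltW.
  rewrite sqr_enorm (bigD1 i)//= lerDl sumr_ge0// => j _; exact: sqr_ge0.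
by rewrite lebesgue_cube ?ltry//; lra.
Qed.

Lemma sphere_measure_unit_sphere_gt0 n : (0 < n)%N ->
  (0 < sphere_measure (@unit_sphere R n))%E.
Proof.
move=> n0; rewrite sphere_measure_unit_sphereE.
have n0R : 0 < n%:R :> R by rewrite ltr0n.
apply: mule_gt0; first by rewrite lte_fin.
(* With all coordinates in ]0, 1/n], each square is at most 1/n, so the norm is positive and at most
   1. *)
apply: (@lt_le_trans _ _ (lebesgue_tuple (@cube n 0 n%:R^-1))).
  rewrite lebesgue_cube ?lte_fin ?subr0; last by rewrite invr_ge0 ltW.
  by rewrite exprn_gt0// invr_gt0.
apply: le_measure; rewrite ?inE.
- exact: measurable_cube.
- exact: measurable_punctured_ball.
move=> x /= xP; apply/andP; split.
  rewrite sqrtr_gt0 (bigD1 (Ordinal n0))//= ltr_wpDr//.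
    by rewrite sumr_ge0// => j _; exact: sqr_ge0.
  by rewrite exprn_gt0//; case/andP: (xP (Ordinal n0)).
rewrite -[leRHS]sqrtr1 ler_wsqrtr//.
apply: (@le_trans _ _ (\sum_(i < n) n%:R^-1)).
  apply: ler_sum => i _; have /andP[xi0 xi1] := xP i.
  rewrite (@le_trans _ _ (n%:R^-1 ^+ 2))//.
    by rewrite ler_pXn2r// nnegrE ?invr_ge0 ltW.
  by rewrite expr2 ler_piMl ?invr_ge0 ?ler0n// invf_le1// ler1n.
by rewrite sumr_const card_ord -[leLHS]mulr_natr mulVf// gt_eqF.
Qed.

End sphere_invariance.

(** * Coordinate reflections and plane rotations *)

Section rotation.
Context {R : realType} (n : nat).
Implicit Types (x : n.-tuple R) (a b : 'I_n) (t : R).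

Definition flip a x : n.-tuple R := shear a true (fun=> 0) x.

(* The rotation of the plane of coordinates [a] and [b] whose half-angle has
   tangent [t], as a product of three transvections. *)
Definition rotation a b t x : n.-tuple R :=
  shear a false (fun y => - t * tnth y b)
    (shear b false (fun y => 2 * t / (1 + t ^+ 2) * tnth y a)
      (shear a false (fun y => - t * tnth y b) x)).

Lemma tnth_flip a x i :
  tnth (flip a x) i = if i == a then - tnth x i else tnth x i.
Proof. by rewrite tnth_mktuple expr1 mulN1r addr0. Qed.

(** The coefficients are the cosine and the sine of the angle in their rational parametrisation, so
    that identities between them are settled by [field]. *)
Lemma tnth_rotation a b t x i : a != b ->
  tnth (rotation a b t x) i =
    if i == a then (1 - t ^+ 2) / (1 + t ^+ 2) * tnth x a
                   - 2 * t / (1 + t ^+ 2) * tnth x b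
    else if i == b then 2 * t / (1 + t ^+ 2) * tnth x a
                   + (1 - t ^+ 2) / (1 + t ^+ 2) * tnth x b
    else tnth x i.
Proof.
move=> ab.
have t0 : 1 + t ^+ 2 != 0 by rewrite gt_eqF// ltr_pwDl// sqr_ge0.
have ba : (b == a) = false by rewrite eq_sym (negbTE ab).
rewrite /rotation /shear !tnth_mktuple !eqxx ?(negbTE ab) ?ba.
rewrite !expr0 !mul1r.
case: eqVneq => [->|ia]; first by rewrite ?(negbTE ab) ?eqxx; field.
by case: eqVneq => [->|ib] //; rewrite ?eqxx; field.
Qed.

End rotation.

(** * Continuous functions of row vectors *)

Lemma continuous_mx {T U : topologicalType} m n (F : T -> 'M[U]_(m, n)) :
  (forall i j, continuous (fun x => F x i j)) -> continuous F.
Proof.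
move=> cF x A [P FP sPA]; rewrite nbhs_simpl /=.
apply: filterS; first by move=> y; exact: sPA.
apply: filter_forall => i; apply: filter_forall => j.
exact: (cF i j x (P i j) (FP i j)).
Qed.

Section row_vectors.
Context {R : realType} (n : nat).
Implicit Types (x y : 'rV[R]_n) (k l : 'rV[R]_n -> R).

Lemma rV_norm_leP x (K : R) : 0 <= K -> `|x| <= K <-> forall i, `|x 0 i| <= K.
Proof.
move=> K0; rewrite {1}/Num.norm /= mx_normrE; split => [xK i|xK].
  apply: le_trans xK.
  exact: (le_bigmax _ (fun ij : 'I_1 * 'I_n => `|x ij.1 ij.2|) (0, i)).
by apply: bigmax_le => // -[j i] _ /=; rewrite ord1.
Qed.

Lemma rV_norm_coord x i : `|x 0 i| <= `|x|.
Proof. exact: (rV_norm_leP x (normr_ge0 x)).1. Qed.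

Lemma compact_rV_norm_le (K : R) : compact [set x : 'rV[R]_n | `|x| <= K].
Proof.
apply: bounded_closed_compact.
  by exists K; split => [|M KM x /= /le_trans]; [exact: num_real|apply;
    exact: ltW].
rewrite (_ : mkset _ = (fun x : 'rV[R]_n => `|x|) @^-1` [set r | r <= K]) //.
apply: closed_comp; last exact: closed_le.
by move=> x _; exact: norm_continuous.
Qed.

Lemma continuous_addf k l : continuous k -> continuous l ->
  continuous (fun x => k x + l x).
Proof. by move=> ck cl x; have := continuousD (ck x) (cl x). Qed.

Lemma continuous_mulf k l : continuous k -> continuous l ->
  continuous (fun x => k x * l x).
Proof. by move=> ck cl x; have := continuousM (ck x) (cl x). Qed.

Lemma continuous_scalef (c : R) k : continuous k ->
  continuous (fun x => c * k x).
Proof. by move=> ck; apply: continuous_mulf => // x; exact: cst_continuous. Qed.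

Lemma continuous_oppf k : continuous k -> continuous (fun x => - k x).
Proof. by move=> ck x; have := continuousN (ck x). Qed.

Lemma continuous_sumf (I : Type) (s : seq I) (F : I -> 'rV[R]_n -> R) :
  (forall i, continuous (F i)) -> continuous (fun x => \sum_(i <- s) F i x).
Proof.
move=> cF; elim: s => [|i s IH].
  by under eq_fun do rewrite big_nil; exact: cst_continuous.
by under eq_fun do rewrite big_cons; exact: continuous_addf.
Qed.

Lemma continuous_dilationf (r : R) k : continuous k ->
  continuous (fun x => k (r *: x)).
Proof.
move=> ck x; apply: (@continuous_comp _ _ _ (fun x => r *: x) k);
  last exact: ck.
exact: scaler_continuous.
Qed.

Lemma continuous_bounded_on k (K : R) : continuous k ->
  exists M, forall x, `|x| <= K -> `|k x| <= M.
Proof.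
move=> ck.
have : compact (k @` [set x | `|x| <= K]).
  apply: continuous_compact; last exact: compact_rV_norm_le.
  exact: continuous_subspaceT.
move=> /compact_bounded [M [_ HM]]; exists (M + 1) => x xK.
by apply: (HM (M + 1)); [rewrite ltrDl|exists x].
Qed.

(** Heine-Cantor on a closed ball. Only [x] is confined to the ball; [y] may lie outside, as happens
    for increments starting on the sphere. *)
Lemma continuous_uniform_on k (K e : R) : continuous k -> 0 < e ->
  exists2 d, 0 < d & forall x y, `|x| <= K -> `|y - x| < d -> `|k y - k x| <= e.
Proof.
move=> ck e0.
have e2 : 0 < e / 2 by rewrite divr_gt0.
have /compact_near_coveringP cov := @compact_rV_norm_le K.
have [|d /= d0 dP] := cov R (0^'+) (fun d x => forall y, `|y - x| < d ->
  `|k y - k x| <= e) _.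
  move=> x _.
  have /cvgrPdist_lt /(_ _ e2) /nbhs_ballP[d /= d0 H] := ck x.
  exists (ball x (d / 2), [set r | r < d / 2]).
    split; first by apply: nbhsx_ballx; rewrite divr_gt0.
    by apply: nbhs_right_lt; rewrite divr_gt0.
  move=> [y r] /= [xy rd] z zy.
  rewrite -ball_normE /= in xy.
  have /= Hy : ball x d y.
    by rewrite -ball_normE /= (lt_trans xy)//; lra.
  have /= Hz : ball x d z.
    rewrite -ball_normE /= (_ : x - z = (x - y) - (z - y)); last first.
      by rewrite opprB addrA subrK.
    rewrite (le_lt_trans (ler_normB _ _))// [d]splitr ltrD// (lt_trans zy)//.
  rewrite (_ : k z - k y = (k x - k y) - (k x - k z)); last by ring.
  rewrite (le_trans (ler_normB _ _))// [e]splitr lerD// ltW//; exact: H.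
exists (d / 2); first by rewrite divr_gt0.
move=> x y xK xy; apply: (dP (d / 2)) => //=.
  by rewrite sub0r normrN gtr0_norm ?divr_gt0//; lra.
by rewrite divr_gt0.
Qed.

(** Integration takes place on tuples, differential calculus on the normed space of row vectors;
    this map joins the two. *)
Definition row_of_tuple (e : n.-tuple R) : 'rV[R]_n := \row_i tnth e i.

(* An open set is a countable union of rational boxes. *)
Lemma measurable_row_of_tuple (U : set 'rV[R]_n) :
  open U -> measurable (row_of_tuple @^-1` U).
Proof.
move=> oU.
pose box (q : n.-tuple rat * nat) : set (n.-tuple R) :=
  [set e | forall i, `|tnth e i - ratr (tnth q.1 i)| < q.2.+1%:R^-1].
have mbox q : measurable (box q).
  rewrite (_ : box q = \bigcap_(i in [set: 'I_n]) ((@tnth n R)^~ i @^-1`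
      ball (ratr (tnth q.1 i) : R) q.2.+1%:R^-1)).
    apply: fin_bigcap_measurable => // i _.
    rewrite -[X in measurable X]setTI; apply: measurable_tnth => //.
    exact: measurable_ball.
  by apply/seteqP; split => e /= H i; have := H i; rewrite /ball /= distrC;
    exact.
(* Boxes that stick out are replaced by the empty set, so the union runs over the whole countable
   index type. *)
pose F q := if pselect (box q `<=` row_of_tuple @^-1` U) then box q else set0.
rewrite (_ : _ @^-1` _ = \bigcup_q F q).
  apply: countable_bigcupT_measurable => [|q].
    exact: countableP.
  by rewrite /F; case: pselect => ?; [exact: mbox|exact: measurable0].
apply/seteqP; split => [e Ue|e [q _]]; last first.
  by rewrite /F; case: pselect => // H; exact: H.
have /nbhs_ballP[d /= d0 H] : nbhs (row_of_tuple e) U by exact: open_nbhs_nbhs.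
(* Two points of one box differ by less than twice its radius in each coordinate. *)
have [m md] : exists m : nat, 2 * m.+1%:R^-1 < d.
  have [m mP] := @ltr_add_invr R 0 (d / 2) (divr_gt0 d0 (ltr0Sn _ _)).
  by exists m; rewrite mulrC -ltr_pdivlMr// -[ltLHS]add0r.
have [r rE] : exists r : R, r = m.+1%:R^-1 by exists m.+1%:R^-1.
have r0 : 0 < r by rewrite rE invr_gt0.
rewrite -rE in md.
have /choice[q qP] (i : 'I_n) : exists q : rat, `|tnth e i - ratr q| < r.
  have /rat_in_itvoo[q] : tnth e i - r < tnth e i + r by lra.
  by rewrite in_itv /= => /andP[? ?]; exists q; rewrite ltr_norml;
    apply/andP; split; lra.
exists ([tuple q i | i < n], m) => //; rewrite /F; case: pselect => [_ i|].
  by rewrite /= tnth_mktuple -rE.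
case=> u /= uq; apply: H; rewrite -ball_normE /=.
rewrite (le_lt_trans _ md)//; apply/rV_norm_leP;
  first by rewrite mulr_ge0// ltW.
move=> i; rewrite !mxE.
have := uq i; rewrite tnth_mktuple -rE => u1; have := qP i => u2.
rewrite (_ : _ - _ = (tnth e i - ratr (q i)) - (tnth u i - ratr (q i)));
  last by ring.
by rewrite (le_trans (ler_normB _ _))//; lra.
Qed.

Lemma measurable_continuous_row k : continuous k ->
  measurable_fun [set: n.-tuple R] (k \o row_of_tuple).
Proof.
move=> ck; apply: (measurability _ (RGenOpens.measurableE R)).
move=> _ [_ [a [b ->] <-]]; rewrite setTI comp_preimage.
apply: measurable_row_of_tuple.
by have /continuousP := ck; apply; exact: interval_open.
Qed.

End row_vectors.

(** * Means over the unit sphere *)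

Section sphere_mean_row.
Context {R : realType} (n : nat) (n0 : (0 < n)%N).
Implicit Types (k : 'rV[R]_n -> R) (a b : 'I_n).
Local Notation sigma := (@sphere_measure R n).
Local Notation S := (@unit_sphere R n).

Definition smean k : R :=
  (@sphere_area R n)^-1 * \int[sigma]_(e in S) k (row_of_tuple e).

Lemma measurable_unit_sphere : measurable S.
Proof.
rewrite (_ : S = (@enorm R n) @^-1` [set 1]) //.
by rewrite -[X in measurable X]setTI; exact: measurable_enorm.
Qed.

Lemma unit_sphereE (e : n.-tuple R) :
  S e <-> \sum_i (row_of_tuple e) 0 i ^+ 2 = 1.
Proof.
rewrite /unit_sphere /=; under eq_bigr do rewrite mxE; rewrite -sqr_enorm.
split=> [->|e1]; first by rewrite expr1n.
by apply/eqP; rewrite -(@eqrXn2 _ 2) ?sqrtr_ge0// e1 expr1n.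
Qed.

(** The norm of a row vector is its sup norm, which the Euclidean norm dominates. *)
Lemma unit_vector_norm_le1 (x : 'rV[R]_n) : \sum_i x 0 i ^+ 2 = 1 -> `|x| <= 1.
Proof.
move=> x1; apply/rV_norm_leP => // i.
rewrite -(@ler_pXn2r _ 2)// ?nnegrE// expr1n real_normK ?num_real// -x1.
by rewrite (bigD1 i)//= lerDl sumr_ge0// => j _; exact: sqr_ge0.
Qed.

Lemma sphere_area_gt0 : 0 < @sphere_area R n.
Proof.
rewrite /sphere_area fine_gt0// sphere_measure_unit_sphere_gt0//=.
exact: sphere_measure_unit_sphere_lty.
Qed.

Lemma integrable_continuous_row k : continuous k ->
  sigma.-integrable S (EFin \o (k \o @row_of_tuple R n)).
Proof.
move=> ck; apply: measurable_bounded_integrable.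
- exact: measurable_unit_sphere.
- exact: sphere_measure_unit_sphere_lty.
- by apply: measurable_funTS; exact: measurable_continuous_row.
have [M kM] := continuous_bounded_on 1 ck.
exists M; split; first exact: num_real.
move=> x Mx e /unit_sphereE/unit_vector_norm_le1/kM H.
exact: le_trans H (ltW Mx).
Qed.

Lemma smean_cst c : smean (fun=> c) = c.
Proof.
rewrite /smean Rintegral_cst; last exact: measurable_unit_sphere.
by rewrite mulrCA mulVf ?mulr1// gt_eqF// sphere_area_gt0.
Qed.

Lemma smeanD k1 k2 : continuous k1 -> continuous k2 ->
  smean (fun x => k1 x + k2 x) = smean k1 + smean k2.
Proof.
move=> c1 c2; rewrite /smean -mulrDr; congr (_ * _); apply: RintegralD.
- exact: measurable_unit_sphere.
- exact: integrable_continuous_row.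
- exact: integrable_continuous_row.
Qed.

Lemma smeanZ c k : continuous k -> smean (fun x => c * k x) = c * smean k.
Proof.
move=> ck; rewrite /smean mulrCA; congr (_ * _); apply: RintegralZl.
- exact: measurable_unit_sphere.
- exact: integrable_continuous_row.
Qed.

Lemma smean_sum (I : Type) (s : seq I) (F : I -> 'rV[R]_n -> R) :
  (forall i, continuous (F i)) ->
  smean (fun x => \sum_(i <- s) F i x) = \sum_(i <- s) smean (F i).
Proof.
move=> cF; elim: s => [|i s IH].
  by under eq_fun do rewrite big_nil; rewrite big_nil smean_cst.
under eq_fun do rewrite big_cons.
by rewrite big_cons -IH smeanD//; exact: continuous_sumf.
Qed.

Lemma smean_le k1 k2 : continuous k1 -> continuous k2 ->
  (forall x : 'rV[R]_n, \sum_i x 0 i ^+ 2 = 1 -> k1 x <= k2 x) ->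
    smean k1 <= smean k2.
Proof.
move=> c1 c2 k12; rewrite /smean ler_wpM2l//.
  by rewrite invr_ge0 ltW// sphere_area_gt0.
apply: le_Rintegral.
- exact: measurable_unit_sphere.
- exact: integrable_continuous_row.
- exact: integrable_continuous_row.
by move=> e /unit_sphereE; exact: k12.
Qed.

Lemma smean_norm_le k c : continuous k ->
  (forall x : 'rV[R]_n, \sum_i x 0 i ^+ 2 = 1 -> `|k x| <= c) ->
    `|smean k| <= c.
Proof.
move=> ck kc; have cc d : continuous (fun _ : 'rV[R]_n => d : R).
  by move=> x; exact: cst_continuous.
rewrite ler_norml; apply/andP; split.
  rewrite -(smean_cst (- c)); apply: smean_le => // x /kc.
  by rewrite ler_norml => /andP[].
rewrite -(smean_cst c); apply: smean_le => // x /kc.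
by rewrite ler_norml => /andP[].
Qed.

(** Change of variables: the image of the sphere measure under [T] is the sphere measure, and [U] is
    the same map read on row vectors. *)
Lemma smean_invariant k (T : n.-tuple R -> n.-tuple R) (U : 'rV[R]_n ->
  'rV[R]_n) :
  continuous k -> measurable_fun setT T ->
  (forall B, measurable B -> lebesgue_tuple (T @^-1` B) = lebesgue_tuple B) ->
  (forall x, enorm (T x) = enorm x) ->
  (forall x, radial_proj (T x) = T (radial_proj x)) ->
  (forall e, row_of_tuple (T e) = U (row_of_tuple e)) ->
  smean (fun x => k (U x)) = smean k.
Proof.
move=> ck mT TL Tn Tr TU; rewrite /smean /Rintegral; congr (_ * fine _).
have TS : T @^-1` S = S by apply/seteqP; split => e /=;
  rewrite /unit_sphere /= Tn.
under eq_integral do rewrite -TU.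
have mk := measurable_continuous_row ck.
have mF : measurable_fun setT (EFin \o (k \o @row_of_tuple R n)).
  exact/measurable_EFinP.
have iF : sigma.-integrable (T @^-1` S) ((EFin \o (k \o @row_of_tuple R n)) \o
  T).
  rewrite TS; apply: (measurable_bounded_integrable (f :=
    k \o @row_of_tuple R n \o T)).
  - exact: measurable_unit_sphere.
  - exact: sphere_measure_unit_sphere_lty.
  - by apply: measurable_funTS; exact: measurableT_comp.
  have [M kM] := continuous_bounded_on 1 ck.
  exists M; split; first exact: num_real.
  move=> x Mx e Se; apply: le_trans (ltW Mx); apply: kM.
  by apply/unit_vector_norm_le1/unit_sphereE; rewrite /unit_sphere /= Tn.
have := integral_pushforward mT mF iF measurable_unit_sphere.
rewrite TS => <-; apply: eq_measure_integral => A mA _.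
exact: sphere_measure_invariant.
Qed.

Definition row_flip a (x : 'rV[R]_n) : 'rV[R]_n :=
  \row_i if i == a then - x 0 i else x 0 i.

Lemma smean_flip a k : continuous k -> smean (fun x => k (row_flip a x)) =
  smean k.
Proof.
move=> ck; apply: (smean_invariant (T := @flip R n a)) => //.
- by apply: measurable_shear.
- by move=> B mB; exact: lebesgue_tuple_shear.
- move=> x; congr Num.sqrt; apply: eq_bigr => i _.
  by rewrite tnth_flip; case: ifP => // _; rewrite sqrrN.
- move=> x; apply: eq_from_tnth => i.
  rewrite tnth_flip !tnth_mktuple expr1 mulN1r addr0.
  rewrite (_ : enorm (flip a x) = enorm x); first by case: ifP => // _;
    rewrite mulNr.
  congr Num.sqrt; apply: eq_bigr => j _.
  by rewrite tnth_flip; case: ifP => // _; rewrite sqrrN.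
- by move=> e; apply/rowP => i; rewrite !mxE tnth_flip.
Qed.

Definition row_rotation a b (t : R) (x : 'rV[R]_n) : 'rV[R]_n :=
  \row_i (if i == a then (1 - t ^+ 2) / (1 + t ^+ 2) * x 0 a
                         - 2 * t / (1 + t ^+ 2) * x 0 b
          else if i == b then 2 * t / (1 + t ^+ 2) * x 0 a
                         + (1 - t ^+ 2) / (1 + t ^+ 2) * x 0 b
          else x 0 i).

Lemma smean_rotation a b t k : a != b -> continuous k ->
  smean (fun x => k (row_rotation a b t x)) = smean k.
Proof.
move=> ab ck.
have t0 : 1 + t ^+ 2 != 0 by rewrite gt_eqF// ltr_pwDl// sqr_ge0.
have rn x : enorm (rotation a b t x) = enorm x.
  congr Num.sqrt; rewrite (bigD1 a)//= (bigD1 b) 1?eq_sym//=.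
  rewrite [RHS](bigD1 a)//= [in RHS](bigD1 b) 1?eq_sym//= !addrA; congr (_ + _).
    rewrite !tnth_rotation// eqxx eq_sym (negbTE ab) eqxx; field.
    exact: t0.
  apply: eq_bigr => i /andP[/negbTE ia /negbTE ib].
  by rewrite tnth_rotation// ia ib.
have m1 c (d : 'I_n) : measurable_fun setT (fun y : n.-tuple R => c * tnth y d).
  by apply: measurable_funM => //; exact: measurable_tnth.
apply: (smean_invariant (T := @rotation R n a b t)) => //.
- do 2 (apply: measurableT_comp; first by apply: measurable_shear).
  exact: measurable_shear.
- move=> B mB.
  pose S d c c' := @shear R n d false (fun y => c * tnth y c').
  have mS d c c' C : measurable C -> measurable (S d c c' @^-1` C).
    by move=> mC; rewrite -[X in measurable X]setTI; apply: measurable_shear.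
  have LS d c c' C : c' != d -> measurable C ->
      lebesgue_tuple (S d c c' @^-1` C) = lebesgue_tuple C.
    by move=> cd mC; apply: lebesgue_tuple_shear => // x y xy; rewrite xy.
  have ba : b != a by rewrite eq_sym.
  transitivity (lebesgue_tuple (S a (- t) b @^-1`
    (S b (2 * t / (1 + t ^+ 2)) a @^-1` (S a (- t) b @^-1` B)))); first by [].
  rewrite LS ?ba//; last exact: (mS _ _ _ _ (mS _ _ _ _ mB)).
  rewrite LS ?ab//; last exact: (mS _ _ _ _ mB).
  by rewrite LS ?ba.
- move=> x; apply: eq_from_tnth => i.
  have rp y j : tnth (@radial_proj R n y) j =
    tnth y j / enorm y by exact: tnth_mktuple.
  rewrite !(rp, tnth_rotation)// rn.
  by case: ifP => _; last case: ifP => _ //; ring.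
- by move=> e; apply/rowP => i; rewrite !mxE tnth_rotation.
Qed.

End sphere_mean_row.

(** * Infinitesimal rotation invariance *)

Section row_calculus.
Context {R : realType} (n : nat) (n0 : (0 < n)%N).
Implicit Types (x y w : 'rV[R]_n) (k l : 'rV[R]_n -> R).
Implicit Types (dk dl : 'I_n -> 'rV[R]_n -> R).

Lemma continuous_uniform_on_family (I : finType) (F : I -> 'rV[R]_n -> R)
    (K e : R) : (forall i, continuous (F i)) -> 0 < e ->
  exists2 d, 0 < d & forall i x y, `|x| <= K -> `|y - x| < d ->
    `|F i y - F i x| <= e.
Proof.
move=> cF e0.
have /choice[d dP] i : exists d, 0 < d /\ forall x y, `|x| <= K ->
    `|y - x| < d -> `|F i y - F i x| <= e.
  by have [d d0 dP] := continuous_uniform_on K (cF i) e0; exists d.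
(* The default 1 gives a positive radius for an empty family too. *)
exists (\big[Num.min/1]_i d i).
  by apply: lt_bigmin => // i _; exact: (dP i).1.
move=> i x y xK xy; apply: (dP i).2 => //; apply: lt_le_trans xy _.
exact: bigmin_le_cond.
Qed.

(** The partial derivatives are carried as explicit data, and the derivative formula is required in
    every direction, so gradients of products, dilations and slices come out as formulas. *)
Definition has_gradient k dk : Prop :=
  (forall c, continuous (dk c)) /\
  forall y w, is_derive y w k (\sum_c w 0 c * dk c y).

Lemma has_gradientM k dk l dl : continuous k -> continuous l ->
  has_gradient k dk -> has_gradient l dl ->
  has_gradient (fun x => k x * l x) (fun c x => dk c x * l x + k x * dl c x).
Proof.
move=> ck cl [cdk gk] [cdl gl]; split.
  by move=> c; apply: continuous_addf; apply: continuous_mulf.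
move=> y w; have := is_deriveM (gk y w) (gl y w).
rewrite (_ : _ *: _ + _ = \sum_c w 0 c * (dk c y * l y + k y * dl c y)) //.
rewrite /GRing.scale /= !mulr_sumr -big_split /=.
by apply: eq_bigr => c _; ring.
Qed.

Lemma has_gradient_coord a : has_gradient (fun x => x 0 a) (fun c _ => (c ==
  a)%:R).
Proof.
split; first by move=> c x; exact: cst_continuous.
move=> y w; rewrite (bigD1 a)//= eqxx mulr1 big1 ?addr0; last first.
  by move=> c /negbTE ->; rewrite mulr0.
apply/is_deriveP.
apply: (@cvg_trans _ ((fun=> w 0 a) @ (0 : R)^')); last exact: cvg_cst.
apply: near_eq_cvg; near=> h; rewrite /= !mxE addrK /GRing.scale /= mulKf//.
by near: h; exact: nbhs_dnbhs_neq.
Unshelve. all: by end_near. Qed.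

Lemma has_gradient_dilation k dk (r : R) : has_gradient k dk ->
  has_gradient (fun x => k (r *: x)) (fun c x => r * dk c (r *: x)).
Proof.
move=> [cdk gk]; split.
  by move=> c; apply: continuous_scalef; exact: continuous_dilationf.
move=> y w; have := gk (r *: y) (r *: w).
rewrite (eq_bigr (fun c => w 0 c * (r * dk c (r *: y)))); last first.
  by move=> c _; rewrite mxE; ring.
by apply: is_derive_quotient => h; rewrite scalerDr !scalerA mulrC.
Qed.

(* First-order form of the rotation invariance of the spherical mean. *)
Lemma smean_angular_derivative k dk a b : continuous k -> has_gradient k dk ->
  a != b -> smean (fun x => x 0 a * dk b x - x 0 b * dk a x) = 0.
Proof.
move=> ck [cdk gk] ab.
have cR t : continuous (fun x => k (row_rotation a b t x)).
  move=> x; apply: (@continuous_comp _ _ _ (@row_rotation R n a b t) k);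
    last exact: ck.
  apply: continuous_mx => i j; rewrite ord1.
  have -> : (fun y => row_rotation a b t y 0 j) = (fun y =>
      if j == a then (1 - t ^+ 2) / (1 + t ^+ 2) * y 0 a
                     - 2 * t / (1 + t ^+ 2) * y 0 b
      else if j == b then 2 * t / (1 + t ^+ 2) * y 0 a
                     + (1 - t ^+ 2) / (1 + t ^+ 2) * y 0 b
      else y 0 j) by apply/funext => y; rewrite mxE.
  have cx c r : continuous (fun x : 'rV[R]_n => r * x 0 c).
    by apply: continuous_scalef; exact: coord_continuous.
  case: (j == a); last case: (j == b); last exact: coord_continuous.
    by apply: continuous_addf => //; exact: continuous_oppf.
  exact: continuous_addf.
have cx i : continuous (fun x => x 0 i) by exact: coord_continuous.
have cM i j : continuous (fun x => x 0 i * dk j x).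
  exact: continuous_mulf.
(* For a rotation with half-angle tangent [t] and sine [v], the cosine is 1 - t v, and the
   derivative of [k] at [x] along the displacement of [x] is v L - t v P. *)
pose L x := x 0 a * dk b x - x 0 b * dk a x.
pose P x := x 0 a * dk a x + x 0 b * dk b x.
have cL : continuous L by apply: continuous_addf => //; exact: continuous_oppf.
have cP : continuous P by exact: continuous_addf.
have key e : 0 < e -> exists2 d, 0 < d & forall t, 0 < t -> t < d ->
    `|t * smean L - t ^+ 2 * smean P| <= t * e.
  move=> e0.
  have nR : 0 < n%:R :> R by rewrite ltr0n.
  (* There are [n] partial derivatives, each multiplied by a displacement of at most 2 v; the total
     error is v e / 2. *)
  pose e' := e / (4 * n%:R); have e'0 : 0 < e' by rewrite divr_gt0// mulr_gt0.
  have [d d0 dP] := continuous_uniform_on_family 1 cdk e'0.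
  (* The displacement has norm at most 2 v, hence at most 4 t, which must stay below [d]. *)
  exists (Num.min 1 (d / 4)); first by rewrite lt_min ltr01 divr_gt0.
  move=> t t0; rewrite lt_min => /andP[t1 td].
  have u0 : 0 < 1 + t ^+ 2 by rewrite ltr_pwDl// sqr_ge0.
  have un : 1 + t ^+ 2 != 0 by rewrite gt_eqF.
  pose v := 2 * t / (1 + t ^+ 2).
  have v0 : 0 < v by rewrite divr_gt0// mulr_gt0.
  have vt : v <= 2 * t.
    rewrite ler_pdivrMr// ler_peMr//; first by rewrite mulr_ge0// ltW.
    by rewrite lerDl sqr_ge0.
  have cE : (1 - t ^+ 2) / (1 + t ^+ 2) = 1 - t * v by rewrite /v; field.
  have H : `|v * smean L - t * v * smean P| <= v * e.
    (* By rotation invariance, adding k(x) minus its rotated value leaves the mean unchanged and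
       makes the integrand small pointwise. *)
    have -> : v * smean L - t * v * smean P =
        smean (fun x => (v * L x + (- (t * v)) * P x) +
           ((- 1) * k (row_rotation a b t x) + k x)).
      have cvL : continuous (fun x => v * L x) by exact: continuous_scalef.
      have ctP : continuous (fun x => - (t * v) * P x) by exact:
        continuous_scalef.
      have cNR : continuous (fun x => -1 * k (row_rotation a b t x)).
        exact: continuous_scalef.
      rewrite [RHS](smeanD (continuous_addf cvL ctP) (continuous_addf cNR ck)).
      rewrite (smeanD cvL ctP) (smeanD cNR ck) (smeanZ _ cL) (smeanZ _ cP).
      by rewrite (smeanZ _ (cR t)) smean_rotation//; ring.
    apply: smean_norm_le => //.
      by do 2 (apply: continuous_addf; do ?exact: continuous_scalef).
    move=> x x1; pose w : 'rV[R]_n := row_rotation a b t x - x.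
    have [s /andP[s0 s1] kd] := MVT_line x (gk ^~ w).
    have xw : x + w = row_rotation a b t x by rewrite addrC subrK.
    rewrite xw in kd.
    have dE i : w 0 i = if i == a then - (t * v) * x 0 a - v * x 0 b
                        else if i == b then v * x 0 a - t * v * x 0 b else 0.
      rewrite /w !mxE cE -/v.
      case: eqVneq => [->|_]; first by ring.
      by case: eqVneq => [->|_]; ring.
    have xi i : `|x 0 i| <= 1.
      by apply: le_trans (rV_norm_coord _ _) (unit_vector_norm_le1 x1).
    have dv i : `|w 0 i| <= 2 * v.
      have tv : t * v <= v by rewrite ler_piMl ?ltW.
      have tv0 : 0 < t * v by rewrite mulr_gt0.
      have av j : `|v * x 0 j| <= v by rewrite normrM gtr0_norm// ler_piMr//
        ltW.
      have atv j : `|t * v * x 0 j| <= v.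
        by rewrite normrM gtr0_norm// (le_trans _ tv)// ler_piMr// ltW.
      rewrite dE (_ : 2 * v = v + v); last by ring.
      case: ifP => _; last case: ifP => _.
      - by rewrite (le_trans (ler_normB _ _))// mulNr normrN lerD.
      - by rewrite (le_trans (ler_normB _ _))// lerD.
      - by rewrite normr0 addr_ge0 ?ltW.
    have dn : `|w| <= 2 * v by apply/rV_norm_leP => //; rewrite mulr_ge0// ltW.
    have -> : v * L x + - (t * v) * P x + (-1 * k (row_rotation a b t x) + k
      x) =
        - \sum_c w 0 c * (dk c (x + s *: w) - dk c x).
      under eq_bigr do rewrite mulrBr.
      rewrite sumrB -kd.
      rewrite (bigD1 a)//= (bigD1 b) 1?eq_sym//= big1 ?addr0; last first.
        by move=> i /andP[/negbTE ia /negbTE ib]; rewrite dE ia ib mul0r.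
      by rewrite !dE eqxx eq_sym (negbTE ab) eqxx /L /P; ring.
    rewrite normrN (le_trans (ler_norm_sum _ _ _))//.
    apply: (@le_trans _ _ (\sum_(c < n) 2 * v * e')).
      apply: ler_sum => c _; rewrite normrM ler_pM//.
      apply: dP; first exact: unit_vector_norm_le1.
      rewrite addrC addKr normrZ ger0_norm//.
      apply: (@le_lt_trans _ _ `|w|); first by rewrite ler_piMl.
      by apply: (le_lt_trans dn); lra.
    rewrite sumr_const card_ord -[leLHS]mulr_natr /e'.
    suff -> : 2 * v * (e / (4 * n%:R)) * n%:R = v * e / 2.
      by rewrite ler_pdivrMr// ler_peMr ?ler1n// mulr_ge0// ltW.
    by field; rewrite gt_eqF.
  have -> : t * smean L - t ^+ 2 * smean P =
      (1 + t ^+ 2) / 2 * (v * smean L - t * v * smean P).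
    by rewrite /v; field.
  rewrite normrM gtr0_norm ?divr_gt0//.
  have -> : t * e = (1 + t ^+ 2) / 2 * (v * e) by rewrite /v; field.
  by rewrite ler_pM2l ?divr_gt0.
apply/eqP; rewrite -normr_eq0; apply/eqP/le_anti; rewrite normr_ge0 andbT.
rewrite -/L; apply/ler_addgt0Pl => e e0; rewrite addr0.
have e2 : 0 < e / 2 by rewrite divr_gt0.
have [d d0 dP] := key _ e2.
pose B := `|smean P| + 1; have B0 : 0 < B by rewrite ltr_wpDl.
have [t [t0 td tB]] : exists t, [/\ 0 < t, t < d & t * B <= e / 2].
  exists (Num.min (d / 2) (e / 2 / B)); split.
  - by rewrite lt_min !divr_gt0.
  - by rewrite gt_min; apply/orP; left; lra.
  - by rewrite -ler_pdivlMr// ge_min lexx orbT.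
have := dP t t0 td.
rewrite expr2 -mulrA -mulrBr normrM (gtr0_norm t0) ler_pM2l// => H.
rewrite (_ : smean L = (smean L - t * smean P) + t * smean P); last by ring.
rewrite (le_trans (ler_normD _ _))// [e]splitr lerD//.
rewrite normrM (gtr0_norm t0); apply: le_trans tB.
by rewrite ler_pM2l// /B lerDl.
Qed.

End row_calculus.

(** * Radial means *)

Section moments.
Context {R : realType} (n : nat) (n0 : (0 < n)%N).
Implicit Types (x : 'rV[R]_n) (k l : 'rV[R]_n -> R).

Lemma continuous_coord (a : 'I_n) : continuous (fun x => x 0 a).
Proof. exact: coord_continuous. Qed.

Lemma smean_eq k l : (forall x, \sum_i x 0 i ^+ 2 = 1 -> k x = l x) ->
  smean k = smean l.
Proof.
move=> kl; rewrite /smean; congr (_ * _); apply: eq_Rintegral => e.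
by rewrite inE => /unit_sphereE; exact: kl.
Qed.

Lemma smean_odd k (a : 'I_n) : continuous k ->
  (forall x, k (row_flip a x) = - k x) -> smean k = 0.
Proof.
move=> ck kN; have := smean_flip a ck.
rewrite (_ : (fun x => _) = (fun x => -1 * k x)); last first.
  by apply/funext => x; rewrite kN mulN1r.
by rewrite smeanZ// => H; lra.
Qed.

Lemma smean_coord (a : 'I_n) : smean (fun x => x 0 a) = 0.
Proof.
apply: (@smean_odd _ a); first exact: continuous_coord.
by move=> x; rewrite mxE eqxx.
Qed.

(** For distinct indices the product is odd under a reflection. The angular identity for x_a x_b
    shows that x_a^2 and x_b^2 have the same mean, and the [n] equal means add up to 1. *)
Lemma smean_coordM (a b : 'I_n) :
  smean (fun x => x 0 a * x 0 b) = if a == b then n%:R^-1 else 0.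
Proof.
have cM i j : continuous (fun x => x 0 i * x 0 j).
  by apply: continuous_mulf; exact: continuous_coord.
case: eqVneq => [->{a}|ab]; last first.
  apply: (@smean_odd _ a) => // x.
  by rewrite !mxE eqxx eq_sym (negbTE ab) mulNr.
have E a : smean (fun x => x 0 a * x 0 a) = smean (fun x => x 0 b * x 0 b).
  have [->//|ab] := eqVneq a b.
  have cc := continuous_coord.
  have := smean_angular_derivative n0 (cM a b)
    (has_gradientM (cc a) (cc b) (has_gradient_coord a) (has_gradient_coord
      b)) ab.
  rewrite (_ : (fun x => _) =
      (fun x => x 0 a * x 0 a + -1 * (x 0 b * x 0 b))); last first.
    by apply/funext => x /=; rewrite !eqxx (negbTE ab) [b == a]eq_sym (negbTE
      ab) /=; ring.
  rewrite smeanD ?smeanZ//; last exact: continuous_scalef.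
  by move=> H; lra.
have : smean (fun x : 'rV[R]_n => \sum_i x 0 i * x 0 i) = 1.
  rewrite -(smean_cst n0 1); apply: smean_eq => x <-.
  by apply: eq_bigr => i _; rewrite expr2.
rewrite smean_sum// (eq_bigr (fun=> smean (fun x => x 0 b * x 0 b))) => [|i
  _]; last exact: E.
rewrite sumr_const card_ord => H.
have nR : n%:R != 0 :> R by rewrite pnatr_eq0 -lt0n.
by apply: (mulIf nR); rewrite mulVf// mulr_natr.
Qed.

End moments.

(** * Expansion of the radial mean and comparison with the value at the centre *)

Section radial_mean.
Context {R : realType} (n : nat) (n0 : (0 < n)%N).
Implicit Types (x y : 'rV[R]_n) (r : R).
Context (g : 'rV[R]_n -> R) (dg : 'I_n -> 'rV[R]_n -> R)
  (ddg : 'I_n -> 'I_n -> 'rV[R]_n -> R)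
  (cg : continuous g) (gdg : has_gradient g dg)
  (gddg : forall c, has_gradient (dg c) (ddg c)).

Let cdg c : continuous (dg c) := gdg.1 c.
Let cddg c d : continuous (ddg c d) := (gddg c).1 d.

Definition laplacian (y : 'rV[R]_n) : R := \sum_c ddg c c y.
(** [radial1] and [radial2] are the first two derivatives of r -> g(r x). *)
Definition radial1 r x : R := \sum_c x 0 c * dg c (r *: x).
Definition radial2 r x : R :=
  \sum_c \sum_d x 0 c * x 0 d * ddg c d (r *: x).

Lemma continuous_radial1 r : continuous (radial1 r).
Proof.
apply: continuous_sumf => c; apply: continuous_mulf;
  first exact: continuous_coord.
exact: continuous_dilationf.
Qed.

Lemma continuous_radial2 r : continuous (radial2 r).
Proof.
apply: continuous_sumf => c; apply: continuous_sumf => d.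
apply: continuous_mulf; last exact: continuous_dilationf.
by apply: continuous_mulf; exact: continuous_coord.
Qed.

Lemma continuous_laplacian : continuous laplacian.
Proof. by apply: continuous_sumf => c; exact: cddg. Qed.

(* Summing the angular identities for the functions x_a (d_b g)(r x) over all
   a <> b gives the polar form of the Laplacian without its angular part. *)
Lemma smean_laplacian_polar r :
  r * smean (fun x => laplacian (r *: x)) =
  r * smean (radial2 r) + n.-1%:R * smean (radial1 r).
Proof.
have cc := @continuous_coord R n.
have cdr c : continuous (fun x => dg c (r *: x)) by exact: continuous_dilationf.
have cddr c d : continuous (fun x => ddg c d (r *: x)) by exact:
  continuous_dilationf.
(* For a <> b this is x_a d_b k - x_b d_a k with k(x) = x_a (d_b g)(r x); the factor 1 is the
   derivative of x_a. *)
pose F a b x := x 0 a * (x 0 a * (r * ddg b b (r *: x))) -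
  x 0 b * (1 * dg b (r *: x) + x 0 a * (r * ddg b a (r *: x))).
have cF a b : continuous (F a b).
  apply: continuous_addf.
    by do 2 (apply: continuous_mulf => //); exact: continuous_scalef.
  apply: continuous_oppf; apply: continuous_mulf => //; apply: continuous_addf.
    exact: continuous_scalef.
  by apply: continuous_mulf => //; exact: continuous_scalef.
have F0 a b : a != b -> smean (F a b) = 0.
  move=> ab.
  have := smean_angular_derivative n0 (continuous_mulf (cc a) (cdr b))
    (has_gradientM (cc a) (cdr b) (has_gradient_coord a)
       (has_gradient_dilation r (gddg b))) ab.
  move=> <-; congr smean; apply/funext => x /=.
  by rewrite eqxx [b == a]eq_sym (negbTE ab) /F /=; ring.
have H : smean (fun x => \sum_a \sum_(b | b != a) F a b x) = 0.
  rewrite (smean_sum n0); last first.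
    move=> a; under eq_fun do rewrite big_mkcond /=.
    by apply: continuous_sumf => b; case: (b != a) => // x;
      exact: cst_continuous.
  rewrite big1// => a _.
  rewrite (_ : (fun x => _) = fun x => \sum_b if b != a then F a b x else 0);
    last first.
    by apply/funext => x; rewrite big_mkcond.
  rewrite (smean_sum n0); last first.
    by move=> b; case: (b != a) => // x; exact: cst_continuous.
  rewrite big1// => b _; case: eqVneq => /= [_|ba]; first exact: smean_cst.
  by rewrite F0// eq_sym.
have E x : \sum_i x 0 i ^+ 2 = 1 -> \sum_a \sum_(b | b != a) F a b x =
    r * laplacian (r *: x) + ((- r) * radial2 r x + (- n.-1%:R) * radial1 r x).
  move=> x1.
  (* The second-order part vanishes for a = b, so its sum may be extended to all [b]; the
     first-order part may not. *)
  pose G a b := x 0 a ^+ 2 * (r * ddg b b (r *: x)) -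
    r * (x 0 b * x 0 a * ddg b a (r *: x)).
  have FG a b : F a b x = G a b - x 0 b * dg b (r *: x) by rewrite /F /G; ring.
  have S a : \sum_(b | b != a) F a b x =
      \sum_b G a b - \sum_(b | b != a) x 0 b * dg b (r *: x).
    under eq_bigr do rewrite FG.
    rewrite sumrB; congr (_ - _).
    have G0 : G a a = 0 by rewrite /G; ring.
    by rewrite [RHS](bigD1 a)//= G0 add0r.
  under eq_bigr do rewrite S.
  rewrite sumrB.
  (* Each [b] is counted once for every [a] other than [b], that is n - 1 times. *)
  have -> : \sum_a \sum_(b | b != a) x 0 b * dg b (r *: x) =
      n.-1%:R * radial1 r x.
    rewrite (exchange_big_dep xpredT)//= /radial1 mulr_sumr.
    apply: eq_bigr => b _.
    rewrite (eq_bigl (fun a => a \in predC1 b)); last first.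
      by move=> a; rewrite !inE eq_sym.
    by rewrite sumr_const cardC1 card_ord mulr_natl.
  have -> : \sum_a \sum_b G a b = r * laplacian (r *: x) - r * radial2 r x.
    rewrite (eq_bigr (fun a => x 0 a ^+ 2 * (r * laplacian (r *: x)) -
        r * \sum_b x 0 b * x 0 a * ddg b a (r *: x))); last first.
      by move=> a _; rewrite sumrB -mulr_sumr -!mulr_sumr.
    by rewrite sumrB -mulr_suml x1 mul1r -mulr_sumr exchange_big.
  ring.
move: H; rewrite (smean_eq E).
have cl : continuous (fun x => laplacian (r *: x)).
  exact/continuous_dilationf/continuous_laplacian.
have c1 := @continuous_radial1 r; have c2 := @continuous_radial2 r.
rewrite smeanD; [|exact: continuous_scalef|by apply: continuous_addf;
  exact: continuous_scalef].
rewrite smeanD; [|exact: continuous_scalef..].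
rewrite !smeanZ// => H.
lra.
Qed.

Definition radial_mean r : R := smean (fun x => g (r *: x)).

Lemma radial_mean0 : radial_mean 0 = g 0.
Proof.
rewrite /radial_mean (_ : (fun x => _) = (fun=> g 0)) ?smean_cst//.
by apply/funext => x; rewrite scale0r.
Qed.

Lemma smean_radial1_0 : smean (radial1 0) = 0.
Proof.
rewrite /radial1 (smean_sum n0); last first.
  move=> c; apply: continuous_mulf; first exact: continuous_coord.
  exact: continuous_dilationf.
rewrite big1// => c _.
rewrite (_ : (fun x => _) = (fun x => dg c 0 * x 0 c)).
  by rewrite smeanZ ?smean_coord ?mulr0//; exact: continuous_coord.
by apply/funext => x; rewrite scale0r mulrC.
Qed.

Lemma smean_radial2_0 : smean (radial2 0) = laplacian 0 / n%:R.
Proof.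
have cM (c d : 'I_n) : continuous (fun x : 'rV[R]_n => x 0 c * x 0 d).
  by apply: continuous_mulf; exact: continuous_coord.
have -> : radial2 0 = fun x => \sum_c \sum_d ddg c d 0 * (x 0 c * x 0 d).
  apply/funext => x; apply: eq_bigr => c _; apply: eq_bigr => d _.
  by rewrite scale0r mulrC.
rewrite (smean_sum n0) => [|c]; last first.
  by apply: continuous_sumf => d; exact: continuous_scalef.
rewrite /laplacian mulr_suml; apply: eq_bigr => c _.
rewrite (smean_sum n0) => [|d]; last exact: continuous_scalef.
rewrite (bigD1 c)//= big1 ?addr0 => [|d dc].
  by rewrite smeanZ// (smean_coordM n0) eqxx.
by rewrite smeanZ// (smean_coordM n0) eq_sym (negbTE dc) mulr0.
Qed.

(** After subtraction of the linear and quadratic terms, the first derivative vanishes at [r] and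
    the second is bounded by [e] near [r]; two mean value steps give the bound, for [h] of either
    sign. *)
Lemma taylor2_remainder (phi phi1 phi2 : R -> R) r h e :
  (forall t, is_derive t (1 : R) phi (phi1 t)) ->
  (forall t, is_derive t (1 : R) phi1 (phi2 t)) ->
  (forall t, `|t - r| <= `|h| -> `|phi2 t - phi2 r| <= e) ->
  `|phi (r + h) - phi r - h * phi1 r - h ^+ 2 / 2 * phi2 r| <= e * h ^+ 2.
Proof.
move=> d1 d2 H.
pose A := phi1 r; pose B := phi2 r.
pose psi t := phi t - (t - r) * A - (t - r) ^+ 2 / 2 * B.
have d1psi t : is_derive t (1 : R) psi (phi1 t - A - (t - r) * B).
  have := d1 t => ?; apply: is_derive_eq.
  rewrite /GRing.scale /=; by field.
have d2psi t : is_derive t (1 : R) (fun t => phi1 t - A - (t - r) * B) (phi2 t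
  - B).
  have := d2 t => ?; apply: is_derive_eq.
  rewrite /GRing.scale /=; by ring.
have hs k (dk : R -> R) : (forall t, is_derive t (1 : R) k (dk t)) ->
    forall w t, is_derive t (w : R) k (w * dk t).
  by move=> D w t; have := is_derive_scale w (D t); rewrite [w *: _]mulr1.
have [s /andP[s0 s1] E1] := MVT_line r (hs _ _ d1psi h).
have [t /andP[t0 t1] E2] := MVT_line r (hs _ _ d2psi (s * h)).
have -> : phi (r + h) - phi r - h * phi1 r - h ^+ 2 / 2 * phi2 r =
    h * (s * h * (phi2 (r + t *: (s * h)) - B)).
  rewrite -E2; transitivity (psi (r + h) - psi r).
    by rewrite /psi /A /B; field.
  by rewrite E1 /A /GRing.scale /=; ring.
rewrite mulrA (_ : h * (s * h) = s * h ^+ 2); last by ring.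
rewrite normrM ger0_norm; last by rewrite mulr_ge0// sqr_ge0.
rewrite mulrC ler_pM//; first by rewrite mulr_ge0// sqr_ge0.
  apply: H; rewrite addrC addKr /GRing.scale /= !normrM (ger0_norm t0)
    (ger0_norm s0).
  by rewrite mulrA ler_piMl// mulr_ile1.
by rewrite ler_piMl// sqr_ge0.
Qed.

(** Taylor's formula holds along each ray with one error bound for the whole sphere, by uniform
    continuity of the second derivatives around the ball of radius |r|; it is then averaged. *)
Lemma radial_mean_expansion r e : 0 < e -> exists2 d, 0 < d & forall h,
  `|h| < d ->
  `|radial_mean (r + h) - radial_mean r - h * smean (radial1 r)
    - h ^+ 2 / 2 * smean (radial2 r)| <= e * h ^+ 2.
Proof.
move=> e0.
have nR : 0 < n%:R :> R by rewrite ltr0n.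
(* [radial2] has n^2 terms, whose coefficients are at most 1 in absolute value on the sphere. *)
pose e' := e / (n%:R * n%:R); have e'0 : 0 < e' by rewrite divr_gt0// mulr_gt0.
pose F (cd : 'I_n * 'I_n) := ddg cd.1 cd.2.
have cF cd : continuous (F cd) by exact: cddg.
have [d d0 dP] := continuous_uniform_on_family `|r| cF e'0.
exists d => // h hd.
have cgr s : continuous (fun x => g (s *: x)) by exact: continuous_dilationf.
have c1 := @continuous_radial1 r; have c2 := @continuous_radial2 r.
have -> : radial_mean (r + h) - radial_mean r - h * smean (radial1 r)
    - h ^+ 2 / 2 * smean (radial2 r) =
    smean (fun x => (g ((r + h) *: x) + (-1) * g (r *: x)) +
      ((- h) * radial1 r x + (- (h ^+ 2 / 2)) * radial2 r x)).
  rewrite smeanD; [|by apply: continuous_addf => //; exact: continuous_scalef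
                   |by apply: continuous_addf; exact: continuous_scalef].
  rewrite (smeanD (cgr _) (continuous_scalef (cgr r))).
  rewrite (smeanD (continuous_scalef c1) (continuous_scalef c2)).
  by rewrite !smeanZ// /radial_mean; ring.
apply: smean_norm_le => //.
  apply: continuous_addf; apply: continuous_addf => //;
    exact: continuous_scalef.
move=> x x1; have xn := unit_vector_norm_le1 x1.
have gx (k : 'rV[R]_n -> R) dk (t : R) : has_gradient k dk ->
    is_derive t (1 : R) (fun t : R => k (t *: x)) (\sum_c x 0 c * dk c (t *:
      x)).
  move=> [_ /(_ (t *: x) x)].
  by apply: is_derive_quotient => s; rewrite [s *: 1]mulr1 scalerDl.
have D1 t : is_derive t (1 : R) (fun t : R => g (t *: x)) (radial1 t x).
  exact: gx.
have D2 t : is_derive t (1 : R) (radial1 ^~ x) (radial2 t x).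
  rewrite /radial1 /radial2.
  have -> : (fun t => \sum_c x 0 c * dg c (t *: x)) =
      \sum_c (fun t : R => x 0 c * dg c (t *: x)).
    by apply/funext => s; rewrite fct_sumE.
  apply: is_derive_sum => c.
  under eq_bigr do rewrite -mulrA.
  rewrite -mulr_sumr; apply: is_deriveZ; exact: gx.
have := @taylor2_remainder (fun t => g (t *: x)) (radial1 ^~ x) (radial2 ^~ x)
  r h e D1 D2 _.
rewrite (_ : _ + _ + (_ + _) = g ((r + h) *: x) - g (r *: x) - h * radial1 r x -
  h ^+ 2 / 2 * radial2 r x); last by ring.
apply => t tr.
have xi i : `|x 0 i| <= 1 by apply: le_trans (rV_norm_coord _ _) xn.
rewrite /radial2 -sumrB.
apply: (@le_trans _ _ (\sum_(c < n) \sum_(d < n) e')); last first.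
  by rewrite !sumr_const !card_ord -[leLHS]mulr_natr -[X in X * _]mulr_natr
    -mulrA divfK// mulf_neq0// gt_eqF.
rewrite (le_trans (ler_norm_sum _ _ _))//; apply: ler_sum => c _.
rewrite -sumrB (le_trans (ler_norm_sum _ _ _))//; apply: ler_sum => j _.
rewrite -mulrBr !normrM -[leRHS]mul1r ler_pM ?mulr_ge0//.
  by rewrite mulr_ile1.
apply: (dP (c, j)); first by rewrite normrZ ler_piMr.
rewrite -scalerBl normrZ; apply: le_lt_trans hd; apply: le_trans tr.
by rewrite ler_piMr.
Qed.

(** The expansion with error constant 1 bounds the increment by |h| (|m1| + |m2| + 1) for small |h|
    <= 1. *)
Lemma continuous_radial_mean : continuous radial_mean.
Proof.
move=> r; apply/cvgrPdist_le => e e0.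
have [d d0 dP] := @radial_mean_expansion r 1 ltr01.
pose C := `|smean (radial1 r)| + `|smean (radial2 r)| + 1.
have C0 : 0 < C by rewrite ltr_wpDl// addr_ge0.
pose m := Num.min d (Num.min 1 (e / C)).
have m0 : 0 < m by rewrite !lt_min d0 ltr01 divr_gt0.
apply/nbhs_ballP; exists m => // s; rewrite /ball /= distrC !lt_min.
move=> /and3P[sd s1 sC].
have rs : r + (s - r) = s by ring.
have := dP _ sd; rewrite rs mul1r.
set h := s - r in sd s1 sC *; set m1 := smean (radial1 r); set m2 := smean _.
move=> E; rewrite distrC.
rewrite (_ : _ - _ = (radial_mean s - radial_mean r - h * m1 - h ^+ 2 / 2 *
  m2) +
  (h * m1 + h ^+ 2 / 2 * m2)); last by ring.
rewrite ltr_pdivlMr// in sC; apply: le_trans (ltW sC).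
rewrite (le_trans (ler_normD _ _))// /C -/m1 -/m2.
have hh : h ^+ 2 <= `|h|.
  by rewrite -[h ^+ 2]ger0_norm ?sqr_ge0// expr2 normrM ler_piMl// ltW.
have h1 : `|h * m1 + h ^+ 2 / 2 * m2| <= `|h| * `|m1| + `|h| * `|m2|.
  rewrite (le_trans (ler_normD _ _))// !normrM lerD2l ler_wpM2r//.
  rewrite -expr2 real_normK ?num_real// [`|2^-1|]gtr0_norm ?invr_gt0//.
  by rewrite (le_trans _ hh)// ler_pdivrMr// ler_peMr ?sqr_ge0 ?ler1n.
lra.
Qed.

Lemma laplacian_le0_of_radial_mean_le :
  (forall r, radial_mean r <= g 0) -> laplacian 0 <= 0.
Proof.
move=> H; rewrite leNgt; apply/negP => l0.
have nR : 0 < n%:R :> R by rewrite ltr0n.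
pose q := laplacian 0 / n%:R; have q0 : 0 < q by rewrite divr_gt0.
(* The error is half of the quadratic coefficient q / 2, so the mean would exceed g(0) for small h >
   0. *)
have q4 : 0 < q / 4 by rewrite divr_gt0.
have [d d0 dP] := @radial_mean_expansion 0 _ q4.
have [h [h0 hd]] : exists h, 0 < h /\ h < d by exists (d / 2); split; lra.
have := dP h; rewrite gtr0_norm// => /(_ hd).
rewrite add0r radial_mean0 smean_radial1_0 smean_radial2_0 -/q mulr0 subr0.
rewrite ler_norml => /andP[+ _].
have := H h; have : 0 < h ^+ 2 by rewrite exprn_gt0.
move: (h ^+ 2) => h2 h20 Hh.
have : 0 < q * h2 by rewrite mulr_gt0.
lra.
Qed.

Lemma radial_mean_le_of_laplacian_le0 :
  (forall y, laplacian y <= 0) -> radial_mean 1 <= g 0.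
Proof.
move=> lap_le0; rewrite leNgt; apply/negP => gM.
have nR : 0 < n%:R :> R by rewrite ltr0n.
(* Half of the gap leaves F(1) - F(0) = eta > 0, which keeps the minimum away from 1. *)
pose eta := (radial_mean 1 - g 0) / 2.
have eta0 : 0 < eta by rewrite divr_gt0// subr_gt0.
pose F r := radial_mean r - eta * r ^+ 2.
have F01 : F 0 < F 1.
  by rewrite /F radial_mean0 expr0n expr1n mulr0 mulr1 subr0 /eta; lra.
have cF : {within `[0 : R, 1], continuous F}.
  apply: continuous_subspaceT => x; apply: continuousB.
    exact: continuous_radial_mean.
  apply: continuousM; first exact: cst_continuous.
  exact: exprn_continuous.
have [c c01 cmin] := EVT_min ler01 cF.
move: c01; rewrite in_itv /= => /andP[c0 c1].
have {}c1 : c < 1.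
  rewrite lt_neqAle c1 andbT; apply/eqP => cE.
  have := cmin 0; rewrite in_itv /= lexx ler01 => /(_ isT).
  by rewrite leNgt cE F01.
(* [al] is the derivative of [F] at [c] and [be] is half of its second derivative. *)
pose al := smean (radial1 c) - 2 * eta * c.
pose be := smean (radial2 c) / 2 - eta.
have expansion e : 0 < e -> exists2 d, 0 < d & forall h, `|h| < d ->
    0 <= c + h -> 0 <= h * al + h ^+ 2 * (be + e).
  move=> e0; have [d d0 dP] := @radial_mean_expansion c _ e0.
  have m0 : 0 < Num.min d (1 - c) by rewrite lt_min d0 subr_gt0.
  exists (Num.min d (1 - c)) => // h; rewrite lt_min => /andP[hd h1] ch0.
  have := dP h hd; rewrite ler_norml => /andP[_ E].
  have := cmin (c + h); rewrite in_itv /= ch0 /=.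
  have hc1 : c + h <= 1 by move: h1; rewrite ltr_norml => /andP[_ ?]; lra.
  move=> /(_ hc1); rewrite /F /al /be => E2.
  have -> : h * (smean (radial1 c) - 2 * eta * c) +
      h ^+ 2 * (smean (radial2 c) / 2 - eta + e) =
      h * smean (radial1 c) + h ^+ 2 / 2 * smean (radial2 c) + e * h ^+ 2
      - eta * ((c + h) ^+ 2 - c ^+ 2) by field.
  lra.
(* At c = 0 the polar identity carries no information and only h >= 0 is admissible; there the
   moments give al = 0 and be <= - eta, against minimality. *)
move: c0; rewrite le_eqVlt => /predU1P[c0|c0].
  have eta2 : 0 < eta / 2 by rewrite divr_gt0.
  have [d d0 dP] := expansion _ eta2.
  have al0 : al = 0 by rewrite /al -c0 smean_radial1_0 mulr0 subr0.
  have be0 : be <= - eta.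
    rewrite /be -c0 smean_radial2_0.
    have : laplacian 0 / n%:R <= 0 by rewrite pmulr_lle0 ?invr_gt0.
    lra.
  have [h [h0 hd]] : exists h, 0 < h /\ h < d by exists (d / 2); split; lra.
  have := dP h; rewrite gtr0_norm// al0 mulr0 add0r -c0 add0r => /(_ hd (ltW
    h0)).
  rewrite pmulr_rge0 ?exprn_gt0//; lra.
have al0 : al = 0.
  apply/eqP/negPn/negP => aln.
  have [d d0 dP] := expansion 1 ltr01.
  have al2 : 0 < al ^+ 2 by rewrite lt_neqAle sqr_ge0 andbT eq_sym sqrf_eq0.
  have an : 0 < `|al| by rewrite normr_gt0.
  have bn : 0 < `|be| + 1 by rewrite ltr_wpDl.
  pose m := Num.min d c; have m0 : 0 < m by rewrite lt_min d0.
  (* The step h = - s al goes downhill: the first bound keeps c + h in the admissible range, the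
     second makes the linear term dominate. *)
  have [s [s0 sm sb]] : exists s, [/\ 0 < s,
    s * `|al| < m & s * (`|be| + 1) < 1].
    exists (Num.min (m / `|al| / 2) ((`|be| + 1)^-1 / 2)); split.
    - by rewrite lt_min !divr_gt0// invr_gt0.
    - rewrite -ltr_pdivlMr// gt_min; apply/orP; left.
      have : 0 < m / `|al| by rewrite divr_gt0.
      lra.
    - rewrite -ltr_pdivlMr// gt_min; apply/orP; right.
      have : 0 < (`|be| + 1)^-1 by rewrite invr_gt0.
      lra.
  have hn : `|- (s * al)| = s * `|al| by rewrite normrN normrM gtr0_norm.
  have sd : s * `|al| < d by apply: lt_le_trans sm _; rewrite ge_min lexx.
  have sc : 0 <= c - s * al.
    have : s * al <= s * `|al| by rewrite ler_pM2l// ler_norm.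
    have : m <= c by rewrite ge_min lexx orbT.
    lra.
  have := dP (- (s * al)); rewrite hn => /(_ sd sc).
  have -> : - (s * al) * al + (- (s * al)) ^+ 2 * (be + 1) =
    (s * al ^+ 2) * (s * (be + 1) - 1) by ring.
  rewrite pmulr_rge0 => [sb1|]; last by rewrite mulr_gt0.
  have : s * (be + 1) <= s * (`|be| + 1) by rewrite ler_pM2l// lerD2r ler_norm.
  lra.
have be0 : 0 <= be.
  apply/ler_addgt0Pr => e e0.
  have [d d0 dP] := expansion _ e0.
  have [h [h0 hd]] : exists h, 0 < h /\ h < d by exists (d / 2); split; lra.
  have := dP h; rewrite gtr0_norm// al0 mulr0 add0r.
  by move=> /(_ hd (addr_ge0 (ltW c0) (ltW h0))); rewrite pmulr_rge0 ?exprn_gt0.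
have := smean_laplacian_polar c.
have : smean (fun x => laplacian (c *: x)) <= 0.
  rewrite -(smean_cst n0 0); apply: smean_le => //.
  - exact/continuous_dilationf/continuous_laplacian.
  - by move=> x; exact: cst_continuous.
move=> Hlap E.
have : c * smean (fun x => laplacian (c *: x)) <= 0 by rewrite pmulr_rle0.
rewrite E.
(* The two conditions at the minimum make the right side of the polar identity positive, while its
   left side is at most 0. *)
have m2 : 2 * eta <= smean (radial2 c) by move: be0; rewrite /be; lra.
have m1 : smean (radial1 c) = 2 * eta * c by move: al0; rewrite /al; lra.
have : 0 < c * smean (radial2 c) by rewrite mulr_gt0//; lra.
have : 0 <= n.-1%:R * smean (radial1 c).
  by apply: mulr_ge0; [exact: ler0n|rewrite m1; apply: ltW;
    do 2 apply: mulr_gt0 => //].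
lra.
Qed.

End radial_mean.

(** * Restriction to rank-one directions *)

Section rank_one_slice.
Context {R : realType} (n p : nat).
Implicit Types (f : 'M[R]_(n, p) -> R) (X : 'M[R]_(n, p)) (rho : 'cV[R]_p).

(** The mean inequality for [X] and r rho concerns this function on the sphere of radius |r| about
    0. *)
Definition slice f X rho (x : 'rV[R]_n) : R := f (X + x^T *m rho^T).

Lemma tr_mulmx_tr (x : 'rV[R]_n) rho a i :
  (x^T *m rho^T) a i = x 0 a * rho i 0.
Proof. by rewrite !mxE big_ord1 !mxE. Qed.

Lemma continuous_slice f X rho : continuous f -> continuous (slice f X rho).
Proof.
move=> cf x.
apply: (@continuous_comp _ _ _ (fun x : 'rV[R]_n => X + x^T *m rho^T) f);
  last exact: cf.
move: x; apply: continuous_mx => i j.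
have -> : (fun x : 'rV[R]_n => (X + x^T *m rho^T) i j) =
    (fun x => X i j + rho j 0 * x 0 i).
  by apply/funext => x; rewrite mxE tr_mulmx_tr mulrC.
apply: continuous_addf; first by move=> x; exact: cst_continuous.
by apply: continuous_scalef; exact: coord_continuous.
Qed.

(** The partial derivatives of a slice are combinations of slices, so this rule yields its second
    derivatives. *)
Lemma has_gradient_lincomb (I : finType) (r : I -> R) (k : I -> 'rV[R]_n -> R)
    (dk : I -> 'I_n -> 'rV[R]_n -> R) : (forall i, has_gradient (k i) (dk i)) ->
  has_gradient (fun x => \sum_i r i * k i x)
    (fun c x => \sum_i r i * dk i c x).
Proof.
move=> kdk; split=> [c|y w].
  by apply: continuous_sumf => i; apply: continuous_scalef; exact: (kdk i).1.
have -> : \sum_c w 0 c * (\sum_i r i * dk i c y) =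
    \sum_i r i * (\sum_c w 0 c * dk i c y).
  under eq_bigr do rewrite mulr_sumr.
  rewrite exchange_big; apply: eq_bigr => i _; rewrite mulr_sumr.
  by apply: eq_bigr => c _; rewrite mulrCA.
elim: (index_enum I) => [|i s IH].
  under eq_fun do rewrite big_nil; rewrite big_nil; exact: is_derive_cst.
under eq_fun do rewrite big_cons; rewrite big_cons.
apply: is_deriveD; apply: is_deriveZ; exact: (kdk i).2.
Qed.

Lemma has_gradient_slice f X rho : C1 f ->
  has_gradient (slice f X rho)
    (fun c x => \sum_i rho i 0 * slice (mx_partial c i f) X rho x).
Proof.
move=> f1; split=> [c|y w].
  apply: continuous_sumf => i; apply: continuous_scalef;
    apply: continuous_slice.
  exact: (f1.2 c i).2.
have := C1_is_derive (X + y^T *m rho^T) (w^T *m rho^T) f1.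
have -> : \sum_a \sum_i (w^T *m rho^T) a i * mx_partial a i f (X + y^T *m
  rho^T) =
    \sum_a w 0 a * \sum_i rho i 0 * slice (mx_partial a i f) X rho y.
  apply: eq_bigr => a _; rewrite mulr_sumr; apply: eq_bigr => i _.
  by rewrite tr_mulmx_tr mulrA.
apply: is_derive_quotient => h; rewrite /slice linearD linearZ /= mulmxDl
  scalemxAl.
by rewrite addrCA.
Qed.

Lemma laplacian_slice f X rho x :
  laplacian (fun c d x => \sum_i rho i 0 *
    \sum_j rho j 0 * slice (mx_partial d j (mx_partial c i f)) X rho x) x =
  (rho^T *m matrix_laplacian f (X + x^T *m rho^T) *m rho) 0 0.
Proof.
rewrite /laplacian !mxE exchange_big /=.
apply: eq_bigr => i _; rewrite !mxE mulr_suml -mulr_sumr.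
rewrite exchange_big mulr_sumr; apply: eq_bigr => j _.
rewrite !mxE /slice -mulr_sumr; ring.
Qed.

Lemma tr_matrix_laplacian f X : C2 f -> (matrix_laplacian f X)^T =
  matrix_laplacian f X.
Proof.
move=> f2; apply/matrixP => i j; rewrite mxE [LHS]mxE [RHS]mxE.
by apply: eq_bigr => a _; rewrite (C2_mixed_partial_sym a j a i f2).
Qed.

Lemma sphere_mean_EFin f X rho : continuous f ->
  sphere_mean (fun X => (f X)%:E) X rho = (smean (slice f X rho))%:E.
Proof.
move=> cf; rewrite /sphere_mean /smean EFinM; congr (_ * _)%E.
(* The integral is finite because a continuous function is integrable over the sphere. *)
rewrite /Rintegral fineK; last first.
  apply: integrable_fin_num; first exact: measurable_unit_sphere.
  exact: (integrable_continuous_row (continuous_slice cf)).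
apply: eq_integral => e _; rewrite /slice; congr (f (_ + _ *m _))%:E.
by apply/colP => i; rewrite !mxE.
Qed.

Lemma continuous_lower_semicontinuous f : continuous f ->
  lower_semicontinuous (fun X => (f X)%:E).
Proof.
move=> cf; apply/lower_semicontinuousP => a.
rewrite (_ : mkset _ = f @^-1` `]a, +oo[); last first.
  by apply/seteqP; split => X /=; rewrite in_itv /= andbT lte_fin.
by have /continuousP := cf; apply; exact: interval_open.
Qed.

End rank_one_slice.

Theorem theorem3p5 (R : realType) (n p : nat) (hn : (0 < n)%N) (hp : (0 < p)%N)
    (f : 'M[R]_(n, p) -> R) (hf : C2 f) :
  matrix_superharmonic (fun X => (f X)%:E) <->
  forall X : 'M[R]_(n, p), loewner_le (matrix_laplacian f X) 0.
Proof.
have [f1 f2] := hf; have cf := f1.1.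
have cs X rho : continuous (slice f X rho) by exact: continuous_slice.
have grad X rho := has_gradient_slice X rho f1.
have hess X (rho : 'cV[R]_p) c := has_gradient_lincomb (fun i => rho i 0)
  (fun i => has_gradient_slice X rho (f2 c i)).
have lapE X rho x := laplacian_slice f X rho x.
have quadN (A : 'M[R]_p) (v : 'cV[R]_p) :
    (v^T *m (0 - A) *m v) 0 0 = - (v^T *m A *m v) 0 0.
  by rewrite sub0r mulmxN mulNmx mxE.
have slice0 X rho : slice f X rho 0 = f X.
  by rewrite /slice trmx0 mul0mx addr0.
split=> [[_ _ _ sm] X|lap_le0].
  (* The semidefinite order also demands symmetry, which comes from equality of mixed partial
     derivatives. *)
  split; first by rewrite raddfB /= trmx0 tr_matrix_laplacian.
  move=> v; rewrite quadN oppr_ge0.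
  have := @laplacian_le0_of_radial_mean_le _ _ hn _ _ _
    (cs X v) (grad X v) (hess X v).
  rewrite lapE trmx0 mul0mx addr0; apply => r.
  have := sm X (r *: v); rewrite sphere_mean_EFin// lee_fin slice0.
  rewrite (_ : slice f X (r *: v) = fun x => slice f X v (r *: x)) //.
  by apply/funext => x; rewrite /slice !linearZ /= -scalemxAl.
split=> //.
- exact: continuous_lower_semicontinuous.
- by exists 0.
move=> X rho; rewrite sphere_mean_EFin// lee_fin -(slice0 X rho).
(* Radius 1 is enough, since [rho] is arbitrary and absorbs the radius. *)
have := @radial_mean_le_of_laplacian_le0 _ _ hn _ _ _
  (cs X rho) (grad X rho) (hess X rho).
rewrite /radial_mean (_ : (fun x => _ (1 *: x)) = slice f X rho); last first.
  by apply/funext => x; rewrite scale1r.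
apply=> y; rewrite lapE.
by have := (lap_le0 (X + y^T *m rho^T)).2 rho; rewrite quadN oppr_ge0.
Qed.
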